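(* Let $k \ge r \ge 3$ be integers. Then: (i) $k(2r-4) \le \alpha(k,r) \le (k-1)(4r-k-6)$ if $r \le k \le 2r-3$, and $k(2r-4) \le \alpha(k,r) \le (k-1)(2r-3)$ if $k \ge 2r-3$. (ii) $\alpha(k,r) = k(2r-4)$ if $k = 2r-3$, or if $k \ge 2r-2$ and $r \equiv 0 \pmod 2$, or if $k \ge 2r-1$ and $r \equiv 2 \pmod 3$. (iii) $\alpha(k,3) = 3(k-1)$ for all $k\ge 3$, $\alpha(4,4) = 18$, and $33 \le \alpha(5,5) \le 36$. (iv) $\alpha(r,r) \ge r(2r-4)+1$ for $r \ge 4$.
   Context: All graphs are finite and simple. A $k$-partite graph comes with a fixed partition of its vertex set into $k$ parts. An edge or non-edge $uv$ is admissible if $u$ and $v$ lie in different parts. A $k$-partite graph is $K_r$-partite-saturated if it contains no $K_r$ but adding any admissible non-edge creates a copy of $K_r$. $\alpha(k,r)$ is the minimum of $e(X, V(G)\setminus X)$ (number of edges between $X$ and its complement) over all pairs $(G,X)$ where $G$ is a $K_r$-partite-saturated $k$-partite graph and $X$ is an independent set of $G$ of size $k$ containing exactly one vertex from each part of $G$. *)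

(* Defs.v *)
From HB Require Import structures.
From mathcomp Require Import all_boot.
From mathcomp Require Import boolp classical_sets.

Set Implicit Arguments.
Unset Strict Implicit.
Unset Printing Implicit Defensive.

Definition simple_graph (V : finType) (e : rel V) : Prop :=
  symmetric e /\ irreflexive e.

(* The fixed partition is given by the map sending a vertex to its part. *)
Definition partite (k : nat) (V : finType) (part : V -> 'I_k) (e : rel V) :
    Prop :=
  forall u v, e u v -> part u != part v.

Definition clique (V : finType) (e : rel V) (S : {set V}) : Prop :=
  {in S &, forall u v, u != v -> e u v}.

Definition independent (V : finType) (e : rel V) (S : {set V}) : Prop :=
  {in S &, forall u v, ~~ e u v}.

Definition contains_K (r : nat) (V : finType) (e : rel V) : Prop :=
  exists2 S : {set V}, #|S| = r & clique e S.

Definition add_edge (V : finType) (e : rel V) (u v : V) : rel V :=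
  fun x y => [|| e x y, (x == u) && (y == v) | (x == v) && (y == u)].

Definition partite_saturated (k r : nat) (V : finType) (part : V -> 'I_k)
    (e : rel V) : Prop :=
  ~ contains_K r e /\
  forall u v, part u != part v -> ~~ e u v -> contains_K r (add_edge e u v).

Definition transversal_set (k : nat) (V : finType) (part : V -> 'I_k)
    (X : {set V}) : Prop :=
  #|X| = k /\ forall i : 'I_k, #|[set x in X | part x == i]| = 1.

(* Each edge between X and its complement is counted once, as the ordered pair
   whose first component lies in X. *)
Definition cut_size (V : finType) (e : rel V) (X : {set V}) : nat :=
  #|[set p : V * V | [&& p.1 \in X, p.2 \notin X & e p.1 p.2]]|.

Definition alpha_value (k r n : nat) : Prop :=
  exists (V : finType) (part : V -> 'I_k) (e : rel V) (X : {set V}),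
    [/\ simple_graph e, partite part e, partite_saturated r part e,
        independent e X /\ transversal_set part X
      & cut_size e X = n].

(* xget picks the minimum, which is unique; it defaults to 0 only when no pair
   (G, X) exists, so a positive lower bound on alpha k r also asserts that the
   minimum is attained. *)
Definition alpha (k r : nat) : nat :=
  xget 0 [set n | alpha_value k r n /\
                  forall m, alpha_value k r m -> n <= m]%classic.

(* Main.v *)
(* Write s = r - 2 and let A_i be the neighbourhood of the vertex x_i of X.  The
   set A_i has no K_{s+1}, any two of the A_i share an s-clique, and a vertex
   outside A_i and outside part i is joined to an s-clique of A_i.  No vertex
   lies in every s-clique of A_i, so Hajnal's inequality for the union and the
   intersection of a family of maximum cliques gives #|A_i| >= 2s.

   Let k = r = s + 2 and call i tight when #|A_i| = 2s.  Equality in Hajnal's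
   inequality makes the s-cliques of A_i closed under majority of triples, so for
   each j there is only one s-clique of A_i avoiding part j, and vertices outside
   A_i are completely joined to it.  At least two parts are leaves of i, that
   is, meet A_i in one vertex.  A leaf l of a tight i is never tight: leaves are
   symmetric among tight indices, and then every choice of an edge between the
   parts i and l inside a clique of A_h and A_h' creates a clique that is too
   large.  So at least two indices are not tight, and at least three when s = 3.

   For the upper bounds, take a graph Y and sets A_i inside Y for which all pairs
   meeting X are saturated, and add edges inside Y while possible: this does not
   change the cut.  In (i), A_i is Y minus part i, where Y is the complement of
   an odd cycle, modified by a step adding one part and three vertices.  In (ii),
   Y is the complement of a cycle of length c (2h + 1) with s = c h and c = 2, 3,
   and A_i is Y minus the residue class of i modulo 2h + 1. *)
Require Import Defs.
From mathcomp Require Import all_boot.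
From mathcomp Require Import boolp zify.

Set Implicit Arguments.
Unset Strict Implicit.
Unset Printing Implicit Defensive.

(** * Cliques, Hajnal's inequality and majorities of three sets *)

Lemma card_sum_mem (T : finType) (S : {set T}) : #|S| = \sum_x (x \in S : nat).
Proof.
by rewrite -sum1_card big_mkcond; apply: eq_bigr => x _; case: (_ \in _).
Qed.

Section Cliques.
Variables (V : finType) (e : rel V).
Hypothesis e_sym : symmetric e.

Lemma clique_sub (S T : {set V}) : T \subset S -> clique e S -> clique e T.
Proof. by move=> /subsetP TS cS x y /TS xS /TS yS; apply: cS. Qed.

Lemma cliqueU (S T : {set V}) :
  clique e S -> clique e T ->
  {in S & T, forall x y, x != y -> e x y} -> clique e (S :|: T).
Proof.
move=> cS cT ST x y /setUP[xS|xT] /setUP[yS|yT] nxy.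
- exact: cS.
- exact: ST.
- by rewrite e_sym; apply: ST => //; rewrite eq_sym.
- exact: cT.
Qed.

Lemma clique_add x (S : {set V}) :
  clique e S -> {in S, forall y, e x y} -> clique e (x |: S).
Proof.
move=> cS xS; apply: cliqueU => //.
  by move=> u v /set1P-> /set1P->; rewrite eqxx.
by move=> u v /set1P-> /xS.
Qed.

(* Exchange step of Hajnal's inequality: replacing [I], [U] by [I :&: Q],
   [U :|: Q] for an [s]-clique [Q] does not decrease [#|U| + #|I|], because
   [I :|: (Q :&: U)] is a clique. *)
Lemma hajnal (s : nat) (B I0 : {set V}) :
  (forall S : {set V}, S \subset B -> clique e S -> #|S| <= s) ->
  (forall x, x \in B -> x \notin I0 ->
     exists S : {set V}, [/\ S \subset B, clique e S, #|S| = s & x \notin S]) ->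
  forall I U : {set V}, I \subset U -> U \subset B ->
    {in I & U, forall x y, x != y -> e x y} ->
  #|U| + #|I| <= #|B| + #|I0|.
Proof.
move=> Bs BQ I; have [n] := ubnP #|I :\: I0|.
elim: n I => // n IH I; rewrite ltnS => le_n U IU UB IUe.
have [sub|/subsetPn[x xI xI0]] := boolP (I \subset I0).
  exact: leq_add (subset_leq_card UB) (subset_leq_card sub).
have xB : x \in B by apply: (subsetP UB); apply: (subsetP IU).
have [Q [QB cQ Qs xQ]] := BQ x xB xI0.
have cIQ : clique e (I :|: Q :&: U).
  apply: cliqueU.
  - by move=> u v uI vI; apply: IUe => //; apply: (subsetP IU).
  - exact: clique_sub (subsetIl _ _) cQ.
  - by move=> u v uI /setIP[_ vU]; apply: IUe.
have subIQ : I :|: Q :&: U \subset B.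
  by rewrite subUset (subset_trans IU UB) (subset_trans (subsetIl _ _) QB).
have leIQ := Bs _ subIQ cIQ.
have step : #|U| + #|I| <= #|U :|: Q| + #|I :&: Q|.
  have := cardsUI U Q; have := cardsUI I (Q :&: U).
  rewrite (setIC U Q) [I :&: (Q :&: U)]setIA.
  rewrite (setIidPl (subset_trans (subsetIl _ _) IU)); lia.
apply: leq_trans step _; apply: IH.
- apply: leq_trans le_n; apply: proper_card; apply/properP; split.
    exact: setSD (subsetIl _ _).
  by exists x; rewrite !inE ?xI0 ?xI // (negbTE xQ) andbF.
- by apply: subset_trans (subsetIl _ _) _; apply: subset_trans IU (subsetUl _ _).
- by rewrite subUset UB.
- move=> u v /setIP[uI uQ] /setUP[vU|vQ] nuv; first exact: IUe.
  exact: cQ.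
Qed.

End Cliques.

Section CliqueParts.
Variables (k : nat) (V : finType) (part : V -> 'I_k) (e : rel V).
Hypothesis e_part : partite part e.

Lemma clique_part_inj (S : {set V}) : clique e S -> {in S &, injective part}.
Proof.
move=> cS x y xS yS; have [//|nxy eq_p] := eqVneq x y.
by have /e_part := cS x y xS yS nxy; rewrite eq_p eqxx.
Qed.

Lemma clique_card_part (S : {set V}) (B : {set 'I_k}) :
  clique e S -> {in S, forall x, part x \notin B} -> #|S| + #|B| <= k.
Proof.
move=> cS SB; rewrite -(card_in_imset (clique_part_inj cS)).
have <- : #|part @: S :|: B| = #|part @: S| + #|B|.
  rewrite cardsU (_ : _ :&: B = set0) ?cards0 ?subn0 //.
  apply/setP => i; rewrite !inE; apply/negbTE/negP => /andP[/imsetP[x xS ->]].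
  exact/negP/SB.
by rewrite -[X in _ <= X]card_ord max_card.
Qed.

(** A point in exactly [m] of the sets is counted [m] times on each side. An upper bound on union
    plus intersection thus bounds the majority set from below. *)
Lemma card_maj (S1 S2 S3 : {set V}) :
  #|S1 :|: S2 :|: S3| + #|S1 :&: S2 :|: S1 :&: S3 :|: S2 :&: S3|
    + #|S1 :&: S2 :&: S3| = #|S1| + #|S2| + #|S3|.
Proof.
rewrite !card_sum_mem -!big_split; apply: eq_bigr => x _; rewrite !inE.
by case: (x \in S1); case: (x \in S2); case: (x \in S3).
Qed.

End CliqueParts.

(** * Neighbourhoods of an independent transversal *)

Lemma cards3 (T : finType) (x y z : T) :
  x != y -> z != x -> z != y -> #|[set x; y; z]| = 3.
Proof.
by move=> xy zx zy; rewrite setUC cardsU1 cards2 !inE (negbTE zx) (negbTE zy) xy.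
Qed.

Section Frame.
Variables (k s : nat) (V : finType) (part : V -> 'I_k) (e : rel V).
(** [A i] stands for the neighbourhood of the transversal vertex of part [i]. [A_pair] and [A_sat]
    express saturation of the non-edges at that vertex, towards transversal and towards arbitrary
    vertices. *)
Variable A : 'I_k -> {set V}.
Hypothesis e_sym : symmetric e.
Hypothesis e_part : partite part e.
Hypothesis e_omega : forall S : {set V}, clique e S -> #|S| <= s.+1.
Hypothesis A_part : forall i y, y \in A i -> part y != i.
Hypothesis A_omega :
  forall i (S : {set V}), S \subset A i -> clique e S -> #|S| <= s.
Hypothesis A_pair : forall i j, i != j ->
  exists S : {set V}, [/\ S \subset A i, S \subset A j, clique e S & #|S| = s].
Hypothesis A_sat : forall i y, part y != i -> y \notin A i ->
  exists S : {set V}, [/\ S \subset A i, {in S, forall z, e y z}, clique e S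
                        & #|S| = s].

(** The [s]-clique shared with [A (part x)] misses [x], since no vertex of [A j] lies in part
    [j]. *)
Lemma A_clique_without i x : x \in A i ->
  exists S : {set V}, [/\ S \subset A i, clique e S, #|S| = s & x \notin S].
Proof.
move=> xA; have [|S [SA Sx cS Ss]] := @A_pair i (part x).
  by rewrite eq_sym A_part.
exists S; split=> //; apply/negP => /(subsetP Sx)/A_part; by rewrite eqxx.
Qed.

(** Hajnal's inequality with [I = U = S] and [I0] empty. *)
Lemma degree_ge i j : i != j -> 2 * s <= #|A i|.
Proof.
move=> /A_pair[S [SA _ cS Ss]].
have := @hajnal _ _ e_sym s (A i) set0 (@A_omega i) _ S S (subxx _) SA cS.
rewrite cards0 addn0 Ss addnn -mul2n; apply.
by move=> x xA _; apply: A_clique_without.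
Qed.

(* If [A i0 = [set y1; y2]] then every [A j] meets [[set y1; y2]], and saturation
   forces a third neighbour of [x_j] unless [j] is the part of [y1], of [y2] or
   of a common neighbour of those two parts. *)
Lemma sum_degree_triangle : s = 1 -> 3 * (k - 1) <= \sum_i #|A i|.
Proof.
move=> s1.
have nadj i x y : x \in A i -> y \in A i -> ~~ e x y.
  move=> xA yA; apply/negP => exy.
  have xy : x != y by apply: contraTneq exy => ->; apply/negP => /e_part; rewrite eqxx.
  have /A_omega : [set x; y] \subset A i by rewrite subUset !sub1set xA yA.
  rewrite s1 cards2 xy => H; suff : false by []; apply: H.
  apply: cliqueU => // u u'.
  - by move=> /set1P-> /set1P->; rewrite eqxx.
  - by move=> /set1P-> /set1P->; rewrite eqxx.
  - by move=> /set1P-> /set1P->.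
have common i j : i != j -> exists2 y, y \in A i & y \in A j.
  case/A_pair => S [SA SB _ Ss]; have : 0 < #|S| by rewrite Ss s1.
  by case/card_gt0P => y yS; exists y; [apply: (subsetP SA)|apply: (subsetP SB)].
have sat i y : part y != i -> y \notin A i -> exists2 z, z \in A i & e y z.
  move=> yi /(A_sat yi)[S [SA yS _ Ss]]; have : 0 < #|S| by rewrite Ss s1.
  by case/card_gt0P => z zS; exists z; [apply: (subsetP SA)|apply: yS].
have ge3 i x y z : x \in A i -> y \in A i -> z \in A i -> x != y -> z != x ->
    z != y -> i \notin [set j | #|A j| == 2].
  move=> xA yA zA xy zx zy; rewrite inE neq_ltn; apply/orP; right.
  have <- := cards3 xy zx zy; apply/subset_leq_card/subsetP => w.
  by rewrite !inE -orbA => /or3P[]/eqP->.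
(* [D] collects the indices of the minimum degree 2; if there are at most three, the degree sum is
   at least [3 * k - 3]. *)
set D := [set j | #|A j| == 2] in ge3.
have D3 : #|D| <= 3.
  have [->|/set0Pn[i0 i0D]] := eqVneq D set0; first by rewrite cards0.
  have /cards2P[y1 [y2 [y12 E]]] : #|A i0| == 2 by move: i0D; rewrite inE.
  have y1A : y1 \in A i0 by rewrite E set21.
  have y2A : y2 \in A i0 by rewrite E set22.
  have cov j : (y1 \in A j) || (y2 \in A j).
    have [<-|ij] := eqVneq i0 j; first by rewrite y1A.
    by have [y] := common _ _ ij; rewrite E => /set2P[]-> ->; rewrite ?orbT.
  have y1N : y1 \notin A (part y1) by apply/negP => /A_part; rewrite eqxx.
  have y2N : y2 \notin A (part y2) by apply/negP => /A_part; rewrite eqxx.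
  have y1a : y1 \in A (part y2) by have := cov (part y2); rewrite (negbTE y2N) orbF.
  have y2b : y2 \in A (part y1) by have := cov (part y1); rewrite (negbTE y1N).
  have [y3 y3b y3a] := common _ _ (A_part y1a).
  have y31 : y3 != y1 by apply: contraTneq y3b => ->.
  have y32 : y3 != y2 by apply: contraTneq y3a => ->.
  apply: leq_trans (_ : #|[set part y1; part y2; part y3]| <= 3); last first.
    by rewrite setUC cardsU1 cards2; case: (_ \notin _); case: (_ != _).
  apply/subset_leq_card/subsetP => j jD; rewrite !inE -orbA.
  apply: contraTT jD; rewrite !negb_or => /and3P[j1 j2 j3].
  (* If [A j] contains just one of [y1], [y2], two further neighbours arise: [z], joined to the
     missing one by saturation, and [w], shared with the [A] of the present one's part. *)
  have [y1j|y1j] := boolP (y1 \in A j); have [y2j|y2j] := boolP (y2 \in A j).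
  - have [y3j|y3j] := boolP (y3 \in A j); first exact: (ge3 _ y1 y2 y3).
    have [|z zA ez] := sat j y3 _ y3j; first by rewrite eq_sym.
    apply: (ge3 _ y1 y2 z) => //; apply: contraTneq ez => ->.
      exact: nadj y3a y1a.
    exact: nadj y3b y2b.
  - have [|z zA ez] := sat j y2 _ y2j; first by rewrite eq_sym.
    have [w wA wb] := common _ _ j1.
    apply: (ge3 _ y1 z w) => //.
    + by apply: contraTneq ez => <-; apply: nadj y2A y1A.
    + by apply: contraTneq wb => ->.
    + by apply: contraTneq ez => <-; apply: nadj y2b wb.
  - have [|z zA ez] := sat j y1 _ y1j; first by rewrite eq_sym.
    have [w wA wa] := common _ _ j2.
    apply: (ge3 _ y2 z w) => //.
    + by apply: contraTneq ez => <-; apply: nadj y1A y2A.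
    + by apply: contraTneq wa => ->.
    + by apply: contraTneq ez => <-; apply: nadj y1a wa.
  - by have := cov j; rewrite (negbTE y1j) (negbTE y2j).
have [k1|k1] := leqP k 1; first by rewrite (eqP k1) muln0.
have : \sum_(i < k) 3 <= \sum_i (#|A i| + (i \in D)).
  apply: leq_sum => i _; rewrite inE.
  have [j ij] : exists j, i != j.
    have : 0 < #|[set~ i]| by rewrite cardsC1 card_ord; move: k1; clear; lia.
    by case/card_gt0P => j; rewrite !inE eq_sym; exists j.
  have := degree_ge ij; rewrite s1; move: #|A i| => n; clear.
  by case: eqP; lia.
have -> : \sum_(i < k) 3 = k * 3 by rewrite sum_nat_const card_ord.
rewrite big_split /=.
rewrite -card_sum_mem; move: D3; set n := \sum_i _; move: n #|D|; clear; lia.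
Qed.

(** * The diagonal case: medians and uniqueness in tight neighbourhoods *)

Hypothesis ks : k = s.+2.

Definition tight i := #|A i| == 2 * s.

(** For [i != j], as [k = s + 2], such a clique has exactly one vertex in every part other than [i]
    and [j]. *)
Definition avoids i j (S : {set V}) :=
  [/\ S \subset A i, clique e S, #|S| = s & {in S, forall x, part x != j}].

Lemma A_avoids i j : i != j -> exists S, avoids i j S /\ avoids j i S.
Proof.
move=> /A_pair[S [SA SB cS Ss]]; exists S; split; split=> //.
  by move=> x /(subsetP SB)/A_part.
by move=> x /(subsetP SA)/A_part.
Qed.

Lemma avoids_part i j l S : avoids i j S -> i != j -> l != i -> l != j ->
  exists2 x, x \in S & part x = l.
Proof.
move=> [SA cS Ss Sj] ij li lj.
have [/existsP[x /andP[xS /eqP]]|/existsPn no] :=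
  boolP [exists x, (x \in S) && (part x == l)]; first by exists x.
have SB : {in S, forall x, part x \notin [set i; j; l]}.
  move=> x xS; rewrite !inE !negb_or A_part ?(subsetP SA) // Sj //=.
  by have := no x; rewrite xS.
have := clique_card_part e_part cS SB.
by rewrite cards3 // Ss; move: ks; clear; lia.
Qed.

(** By Hajnal's inequality union and intersection have total size at most [2 * s], so the majority
    set has at least [s] elements. It is a clique, as any two members share one of the three
    cliques, and with [k = s + 2] it cannot miss the three parts [i], [j], [l]. *)
Lemma median i (S1 S2 S3 : {set V}) j l :
  tight i -> S1 \subset A i -> S2 \subset A i -> S3 \subset A i ->
  clique e S1 -> clique e S2 -> clique e S3 ->
  #|S1| = s -> #|S2| = s -> #|S3| = s ->
  j != i -> l != i -> j != l ->
  exists2 x, x \in S1 :&: S2 :|: S1 :&: S3 :|: S2 :&: S3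
    & (part x == j) || (part x == l).
Proof.
move=> /eqP ti A1 A2 A3 c1 c2 c3 s1 s2 s3 ji li jl.
set M := _ :|: S2 :&: S3.
have [/existsP[x /andP[]]|/existsPn no] :=
  boolP [exists x, (x \in M) && ((part x == j) || (part x == l))].
  by exists x.
have cM : clique e M.
  move=> x y; rewrite !inE => xM yM nxy.
  have [/andP[x1 y1]|/andP[x2 y2]|/andP[x3 y3]] : [\/ (x \in S1) && (y \in S1),
    (x \in S2) && (y \in S2) | (x \in S3) && (y \in S3)].
  - case: (x \in S1) (x \in S2) (x \in S3) (y \in S1) (y \in S2) (y \in S3)
      xM yM => [] [] [] [] [] [] //= _ _;
    by [constructor 1|constructor 2|constructor 3].
  - exact: c1.
  - exact: c2.
  - exact: c3.
have MA : M \subset A i.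
  by rewrite !subUset !(subset_trans (subsetIl _ _)).
have Ms : s <= #|M|.
  have := card_maj S1 S2 S3; rewrite -/M s1 s2 s3.
  have := @hajnal _ _ e_sym s (A i) set0 (@A_omega i) _
    (S1 :&: S2 :&: S3) (S1 :|: S2 :|: S3).
  rewrite cards0 ti => H; suff : #|S1 :|: S2 :|: S3| + #|S1 :&: S2 :&: S3|
    <= 2 * s + 0 by clear; lia.
  apply: H.
  - by move=> x xA _; apply: A_clique_without.
  - by apply: subset_trans (subsetIr _ _) (subsetUr _ _).
  - by rewrite !subUset A1 A2 A3.
  - move=> x y /setIP[/setIP[x1 x2] x3] /setUP[/setUP[]|] yS nxy.
    + exact: c1.
    + exact: c2.
    + exact: c3.
have MB : {in M, forall x, part x \notin [set i; j; l]}.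
  move=> x xM; rewrite !inE -!orbA negb_or A_part ?(subsetP MA) //=.
  by have := no x; rewrite xM.
have := clique_card_part e_part cM MB.
rewrite cards3; [move: ks Ms; clear; lia|by rewrite eq_sym|by []|by rewrite eq_sym].
Qed.

(** For [x] in [S] but not in [T], take the median with a clique [R] avoiding part [part x]. It has
    no vertex in part [j], and one in part [part x] must lie in both [S] and [T], hence equals
    [x]. *)
Lemma avoids_uniq i j S T : tight i -> i != j -> avoids i j S -> avoids i j T -> S = T.
Proof.
move=> ti ij [SA cS Ss Sj] [TA cT Ts Tj].
apply/eqP; rewrite eqEcard Ss Ts leqnn andbT; apply/subsetP => x xS.
have [//|xT] := boolP (x \in T).
have xi : part x != i by rewrite A_part ?(subsetP SA).
have [R [RA cR Rs Rx]] : exists R, avoids i (part x) R.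
  have [|R [R1 R2]] := @A_avoids i (part x); first by rewrite eq_sym.
  by exists R.
have ji : j != i by rewrite eq_sym.
have jx : j != part x by rewrite eq_sym Sj.
have [w wM /orP[/eqP wj|/eqP wx]] := median ti SA TA RA cS cT cR Ss Ts Rs ji xi jx.
  have : (w \in S) || (w \in T).
    by move: wM; rewrite !inE; case: (w \in S) => //=; case: (w \in T).
  by case/orP => [/Sj|/Tj]; rewrite wj eqxx.
have wR : w \notin R by apply/negP => /Rx; rewrite wx eqxx.
move: wM; rewrite !inE (negbTE wR) !andbF !orbF => /andP[wS wT].
by case/negP: xT; rewrite -(clique_part_inj e_part cS wS xS wx).
Qed.

(** The clique given by saturation is joined to [y], so it avoids the part of [y] and by uniqueness
    is [S]. *)
Lemma tight_complete i y S : tight i -> part y != i -> y \notin A i ->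
  avoids i (part y) S -> {in S, forall z, e y z}.
Proof.
move=> ti yi yA nS; have [T [TA yT cT Ts]] := A_sat yi yA.
rewrite (avoids_uniq (T := T) ti _ nS) //; first by rewrite eq_sym.
by split=> // z /yT/e_part; rewrite eq_sym.
Qed.

(** * Leaves of tight indices *)

Definition leaf i l f :=
  [/\ f \in A i, part f = l & forall y, y \in A i -> part y = l -> y = f].

Lemma leaf_neq i l f : leaf i l f -> i != l.
Proof. by case=> /A_part + <-; rewrite eq_sym. Qed.

Lemma leaf_mem i l f j S : leaf i l f -> i != j -> j != l -> avoids i j S -> f \in S.
Proof.
move=> lf ij jl nS; have il := leaf_neq lf; case: lf => fA fl fu.
have [||x xS xl] := avoids_part nS ij (l := l); [by rewrite eq_sym|by rewrite eq_sym|].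
by rewrite -(fu x) //; case: nS => SA *; apply: (subsetP SA).
Qed.

(** The [s]-clique shared by [A i] and [A j] meets part [l], where [f] is the only vertex of
    [A i]. *)
Lemma leaf_full i l f j : leaf i l f -> j != l -> f \in A j.
Proof.
move=> lf jl; have [<-|ij] := eqVneq i j; first by case: lf.
have [S [nS [SA _ _ _]]] := A_avoids ij.
by apply: (subsetP SA); apply: leaf_mem lf ij jl nS.
Qed.

(** If [f] were joined to all of [S], then [f |: S] would be too large. Cliques avoiding a part
    other than [l] contain [f], hence miss the set [W] of its non-neighbours; Hajnal's inequality in
    [A i :\: W] with [I0 = [set f]] leaves room for only one. *)
Lemma leaf_nonadj i l f S : tight i -> leaf i l f -> avoids i l S ->
  exists v, [/\ v \in S, ~~ e f v
    & forall y, y \in A i -> y != f -> y != v -> e f y].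
Proof.
move=> ti lf [SA cS Ss Sl]; have il := leaf_neq lf.
have [/existsP[v /andP[vS fv]]|/existsPn no] :=
  boolP [exists v, (v \in S) && ~~ e f v]; last first.
  have fS : f \notin S by apply/negP => /Sl; case: lf => _ -> _; rewrite eqxx.
  have := @A_omega i (f |: S).
  rewrite subUset sub1set SA cardsU1 fS Ss add1n ltnn; case: lf => -> _ _.
  move=> /(_ isT) H; suff : false by []; apply: H; apply: clique_add => // y yS.
  by have := no y; rewrite yS negbK.
exists v; split=> // y yA yf yv; apply: contraT => fy.
pose W := [set w in A i | (w != f) && ~~ e f w].
have W2 : 2 <= #|W|.
  have vf : v != f.
    by apply/eqP => vf; move: (Sl _ vS); rewrite vf; case: lf => _ -> _; rewrite eqxx.
  have <- : #|[set y; v]| = 2 by rewrite cards2 yv.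
  apply: subset_leq_card.
  by apply/subsetP => w /set2P[]->; rewrite !inE ?yA ?yf ?fy ?(subsetP SA) ?vf.
have WA : W \subset A i by apply/subsetP => w; rewrite inE => /andP[].
have nearW j T : i != j -> j != l -> avoids i j T -> T \subset A i :\: W.
  move=> ij jl nT; have fT := leaf_mem lf ij jl nT; case: nT => TA cT Ts Tj.
  apply/subsetP => w wT; rewrite !inE (subsetP TA) //= andbT negb_and negbK.
  by have [//|wf] := eqVneq w f; rewrite negbK cT // eq_sym.
(* A starting clique for Hajnal's inequality is needed; [y] names a part to avoid. *)
have [m mS ml] : exists2 m, part m != i & part m != l.
  exists y; first exact: A_part.
  by apply/eqP => yl; case: lf => _ _ /(_ y yA yl) /eqP; apply/negP.
have [T [nT _]] : exists T, avoids i (part m) T /\ avoids (part m) i T.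
  by apply: A_avoids; rewrite eq_sym.
have TW : T \subset A i :\: W by apply: nearW nT; rewrite // eq_sym.
case: (nT) => TA cT Ts Tj.
have := @hajnal _ _ e_sym s (A i :\: W) [set f].
move=> /(_ _ _ T T (subxx _) TW cT).
rewrite cards1 Ts cardsD (setIidPr WA) (eqP ti) => H.
have : s + s <= 2 * s - #|W| + 1; last first.
  by move: W2 (subset_leq_card WA); rewrite (eqP ti); move: #|W|; clear; lia.
apply: H.
  by move=> R RA; apply: (@A_omega i); apply: subset_trans RA (subsetDl _ _).
move=> x /setDP[xA _]; rewrite inE => xf.
have xl : part x != l.
  by apply/eqP => xl; case: lf => _ _ /(_ x xA xl) /eqP; apply/negP.
have ix : i != part x by rewrite eq_sym A_part.
have [R [nR _]] := A_avoids ix; exists R; split; try by case: nR.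
  by apply: nearW nR.
by case: nR => _ _ _ Rx; apply/negP => /Rx; rewrite eqxx.
Qed.

Lemma leaf_swap i l f S v : leaf i l f -> avoids i l S ->
  v \in S -> (forall y, y \in A i -> y != f -> y != v -> e f y) ->
  avoids i (part v) (f |: S :\ v).
Proof.
move=> [fA fl _] [SA cS Ss Sl] vS fy.
have fS : f \notin S by apply/negP => /Sl; rewrite fl eqxx.
split.
- by rewrite subUset sub1set fA (subset_trans (subsetDl _ _)).
- apply: clique_add (clique_sub (subsetDl _ _) cS) _ => // y.
  rewrite !inE => /andP[yv yS]; apply: fy; rewrite ?(subsetP SA) //.
  by apply: contraNneq fS => <-.
- by rewrite cardsU1 !inE (negbTE fS) andbF /= -Ss (cardsD1 v S) vS.
- move=> x; rewrite !inE => /orP[/eqP->|/andP[xv xS]].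
    by rewrite fl eq_sym Sl.
  by apply: contra xv => /eqP xv; apply/eqP; apply: (clique_part_inj e_part cS).
Qed.

(** Otherwise all the [Q r] survive in [A l :\ y], and Hajnal's inequality gives [2 * s] vertices
    where only [2 * s - 1] remain. *)
Lemma avoids_cover l (Q : 'I_k -> {set V}) y : tight l ->
  (forall j, j != l -> avoids l j (Q j)) -> y \in A l ->
  exists2 r, r != l & y \in Q r.
Proof.
move=> tl HQ yA.
have [/existsP[r /andP[rl yr]]|/existsPn no] :=
  boolP [exists r, (r != l) && (y \in Q r)]; first by exists r.
have yl := A_part yA.
have QA r : r != l -> Q r \subset A l :\ y.
  move=> rl; rewrite subsetD1; have := no r; rewrite rl /= => ->.
  by case: (HQ r rl) => ->.
have [_ cQ Qs _] := HQ _ yl.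
have := @hajnal _ _ e_sym s (A l :\ y) set0.
move=> /(_ _ _ (Q (part y)) _ (subxx _) (QA _ yl) cQ) H.
have : #|Q (part y)| + #|Q (part y)| <= #|A l :\ y| + #|@set0 V|; last first.
  rewrite Qs cards0; move: tl; rewrite /tight (cardsD1 y (A l)) yA.
  by move: #|_ :\ _| => n; clear; lia.
apply: H.
  by move=> R RA; apply: (@A_omega l); apply: subset_trans RA (subsetDl _ _).
move=> x /setD1P[_ xA] _; have xl := A_part xA.
exists (Q (part x)); have [_ cx sx nx] := HQ _ xl; split=> //; first exact: QA.
by apply/negP => /nx; rewrite eqxx.
Qed.

(* Fix two elements [z], [z1] of [A l] in part [i] and let [J] be the set of the
   [j] for which the clique of [A l] avoiding part [j] contains [z].  Medians
   show that, inside [J] and outside [J], the cliques [Q j] agree with [S0] as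
   soon as [j] lies on the other side, so the part of [S0] over [J] can be glued
   to the complementary part of a clique of [A i] avoiding some [r] in [J]; the
   result is a clique of size [s.+1] in [A i]. *)
Lemma leaf_sym i l f : tight i -> tight l -> leaf i l f -> exists g, leaf l i g.
Proof.
move=> ti tl lf; have il := leaf_neq lf.
have li : l != i by rewrite eq_sym.
have [S0 [n0 n0']] := A_avoids il.
have [v [vS fv fy]] := leaf_nonadj ti lf n0.
have [S0i cS0 S0s S0l] := n0; have [S0A _ _ S0i'] := n0'.
have /choice[Q HQ] : forall j, exists S, j != l -> avoids l j S.
  move=> j; have [->|jl] := eqVneq j l; first by exists set0.
  by have [|S [nS _]] := @A_avoids l j; [rewrite eq_sym | exists S].
have Qi : Q i = S0 by apply: (avoids_uniq tl li) => //; apply: HQ.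
have vl : part v != l by apply: S0l.
have vi : part v != i by apply: S0i'.
have lv : l != part v by rewrite eq_sym.
have iv : i != part v by rewrite eq_sym.
(* [z1] will be the leaf; a second vertex [z] of [A l] in part [i] is to be refuted. *)
have [z1 z1Q z1i] := avoids_part (HQ _ vl) lv il iv.
exists z1; split=> //; first by case: (HQ _ vl) => /subsetP->.
move=> z zA zi; apply/eqP; apply: contraT => zz1.
pose J := [set j | [&& j != l, j != i & z \in Q j]].
have Jl j : j \in J -> j != l by rewrite inE => /and3P[].
have Ji j : j \in J -> j != i by rewrite inE => /and3P[].
have Jz j : j \in J -> z \in Q j by rewrite inE => /and3P[].
have JzN j : j != l -> j \notin J -> z \notin Q j.
  move=> jl; have [->|ji] := eqVneq j i; last by rewrite inE jl ji.
  by move=> _; rewrite Qi; apply/negP => /S0i'; rewrite zi eqxx.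
(* Hence [v], the only other vertex of [A i] not joined to [f], is outside the piece of [S0] over
   [J]. *)
have vJ : part v \notin J.
  apply/negP => /Jz zQ; case: (HQ _ vl) => _ cQ _ _; case/eqP: zz1.
  by apply: (clique_part_inj e_part cQ); rewrite // zi z1i.
(* Median of [S0], [Q j] and [Q (part w)]: in part [i] it would be [z], which [Q j] lacks, so it is
   [w]. *)
have inJ w j : w \in S0 -> part w \in J -> j != l -> j \notin J -> w \in Q j.
  move=> wS wJ jl jJ; have [->|ji] := eqVneq j i; first by rewrite Qi.
  have [Aj cj sj nj] := HQ j jl; have [Aw cw sw nw] := HQ _ (Jl _ wJ).
  have iw : i != part w by rewrite eq_sym Ji.
  have [x xM /orP[/eqP xi|/eqP xw]] :=
    median tl S0A Aj Aw cS0 cj cw S0s sj sw il (Jl _ wJ) iw.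
    have xS : x \notin S0 by apply/negP => /S0i'; rewrite xi eqxx.
    move: xM; rewrite !inE (negbTE xS) /= => /andP[xj xQw].
    have xz : x = z.
      by apply: (clique_part_inj e_part cw); rewrite ?Jz // xi zi.
    by have := JzN j jl jJ; rewrite -xz xj.
  have xQw : x \notin Q (part w) by apply/negP => /nw; rewrite xw eqxx.
  move: xM; rewrite !inE (negbTE xQw) !andbF !orbF => /andP[xS xj].
  by rewrite -(clique_part_inj e_part cS0 xS wS xw).
have outJ r y : r \in J -> part y \notin J -> part y != i -> part y != l ->
    y \in Q r -> y \in S0.
  move=> rJ yJ yi yl yQ.
  have [Ar cr sr nr] := HQ _ (Jl _ rJ); have [Ay cy sy ny] := HQ _ yl.
  have iy : i != part y by rewrite eq_sym.
  have [x xM /orP[/eqP xi|/eqP xy]] :=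
    median tl S0A Ar Ay cS0 cr cy S0s sr sy il yl iy.
    have xS : x \notin S0 by apply/negP => /S0i'; rewrite xi eqxx.
    move: xM; rewrite !inE (negbTE xS) /= => /andP[xr xQy].
    have xz : x = z.
      by apply: (clique_part_inj e_part cr); rewrite ?Jz // xi zi.
    by have := JzN _ yl yJ; rewrite -xz xQy.
  have xQy : x \notin Q (part y) by apply/negP => /ny; rewrite xy eqxx.
  move: xM; rewrite !inE (negbTE xQy) !andbF !orbF => /andP[xS xr].
  by rewrite -(clique_part_inj e_part cr xr yQ xy).
have [r rl zr] := avoids_cover tl HQ zA.
have ri : r != i.
  apply/eqP => ri; move: zr; rewrite ri Qi => /S0i'; by rewrite zi eqxx.
have rJ : r \in J by rewrite inE rl ri.
have ir : i != r by rewrite eq_sym.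
have [T [nT _]] := A_avoids ir; have [TA cT Ts Tr] := nT.
pose K := [set w in S0 | part w \in J] :|: [set y in T | part y \notin J].
have KA : K \subset A i.
  rewrite subUset; apply/andP; split; apply/subsetP => x; rewrite inE => /andP[].
    by move=> /(subsetP S0i).
  by move=> /(subsetP TA).
have cK : clique e K.
  apply: cliqueU => //.
  - by apply: clique_sub cS0; apply/subsetP => x; rewrite inE => /andP[].
  - by apply: clique_sub cT; apply/subsetP => x; rewrite inE => /andP[].
  move=> w y; rewrite inE => /andP[wS wJ]; rewrite inE => /andP[yT yJ] wy.
  have yA := subsetP TA _ yT; have yi := A_part yA.
  (* Cross pairs: in part [l], [y] is [f]; inside [A l], some [Q q] contains [y], and [outJ] or
     [inJ] puts both ends in one clique; outside [A l], [y] is joined to all of [Q (part y)]. *)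
  have [yl|yl] := eqVneq (part y) l.
    have -> : y = f by case: lf => _ _; apply.
    rewrite e_sym fy //; first exact: (subsetP S0i).
      by apply/eqP => wf; move: (S0l w wS); rewrite wf; case: lf => _ -> _; rewrite eqxx.
    by apply/eqP => wv; move: vJ; rewrite -wv wJ.
  have [yAl|yAl] := boolP (y \in A l).
    have [q ql yq] := avoids_cover tl HQ yAl.
    have [qJ|qJ] := boolP (q \in J).
      by apply: cS0 => //; apply: outJ qJ _ _ _ yq.
    by have [_ cq _ _] := HQ q ql; apply: cq => //; apply: inJ.
  rewrite e_sym.
  exact: (tight_complete tl yl yAl (HQ _ yl) (inJ _ _ wS wJ yl yJ)).
(* [K] meets every part but [i]: over [J] by [S0], elsewhere by [T], which besides [i] misses only
   [r], a member of [J]. *)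
have : k.-1 <= #|K|; last first.
  by have := A_omega KA cK; move: ks #|K|; clear; lia.
rewrite -(card_in_imset (clique_part_inj e_part cK)).
have <- : #|[set~ i]| = k.-1 by rewrite cardsC1 card_ord.
apply/subset_leq_card/subsetP => q; rewrite in_setC1 => qi.
have [qJ|qJ] := boolP (q \in J).
  have [w wS wq] := avoids_part n0 il qi (Jl _ qJ).
  by apply/imsetP; exists w => //; apply/setUP; left; rewrite inE wS wq.
have qr : q != r by apply: contraNneq qJ => ->.
have [w wS wq] := avoids_part nT ir qi qr.
by apply/imsetP; exists w => //; apply/setUP; right; rewrite inE wS wq.
Qed.

(** Let [v] be the non-neighbour of [g] in the common clique. If [f] and [g] were adjacent, [g]
    would extend the [s]-clique [T] shared by [A i] and [A (part v)] inside [A (part v)]. *)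
Lemma leaf_pair_nonadj i l f g : tight i -> tight l -> leaf i l f -> leaf l i g ->
  ~~ e f g.
Proof.
move=> ti tl lf lg; have il := leaf_neq lf; have li := leaf_neq lg.
have [S0 [n0 n0']] := A_avoids il.
have [v [vS gv gy]] := leaf_nonadj tl lg n0'.
have [S0i cS0 S0s S0l] := n0; have [S0A _ _ S0i'] := n0'.
have [fA fl fu] := lf; have [gA gi gu] := lg.
have vl := S0l v vS; have vi := S0i' v vS.
apply/negP => efg; have iv : i != part v by rewrite eq_sym.
have [T [nT nT']] := A_avoids iv.
have [TA cT Ts Tv] := nT; have [TAv _ _ Ti] := nT'.
have gT : g \notin T by apply/negP => /Ti; rewrite gi eqxx.
have : #|g |: T| <= s; last by rewrite cardsU1 gT Ts add1n ltnn.
apply: (@A_omega (part v)).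
  by rewrite subUset sub1set TAv andbT (leaf_full lg).
apply: clique_add => // y yT; have yA := subsetP TA _ yT; have yi := A_part yA.
have [yl|yl] := eqVneq (part y) l; first by rewrite (fu y yA yl) e_sym.
have [yAl|yAl] := boolP (y \in A l).
  apply: gy => //; first by apply: contraNneq gT => <-.
  by apply: contraTneq yT => ->; apply/negP => /Tv; rewrite eqxx.
have ly : l != part y by rewrite eq_sym.
have [Q [nQ _]] := A_avoids ly.
rewrite e_sym; apply: (tight_complete tl yl yAl nQ).
by apply: (leaf_mem lg ly _ nQ).
Qed.

(** Exchanging [v] for [g] in [S] gives, by uniqueness, the clique shared by [A l] and [A (part v)].
    Since [b] is joined to [S], adjacency to [g] would enlarge it inside [A (part v)]. *)
Lemma leaf_cross_nonadj i l g S v b : tight i -> tight l -> leaf l i g ->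
  avoids i l S -> avoids l i S -> v \in S ->
  (forall y, y \in A l -> y != g -> y != v -> e g y) ->
  part b = l -> b \notin A i -> b \in A (part v) -> ~~ e g b.
Proof.
move=> ti tl lg n0 n0' vS gy bl bA bv; have li := leaf_neq lg.
have [S0i cS0 S0s S0l] := n0; have [S0A _ _ S0i'] := n0'.
have vl := S0l v vS; have vi := S0i' v vS.
have nT := leaf_swap lg n0' vS gy; set T := _ |: _ in nT.
have [gA gi gu] := lg; have [TA cT Ts Tv] := nT.
apply/negP => egb; have lv : l != part v by rewrite eq_sym.
have TAv : T \subset A (part v).
  have [T' [nT1 [TA' _ _ _]]] := A_avoids lv.
  by rewrite (avoids_uniq tl lv nT nT1).
have bT : b \notin T by apply/negP => /(subsetP TA)/A_part; rewrite bl eqxx.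
have : #|b |: T| <= s; last by rewrite cardsU1 bT Ts add1n ltnn.
apply: (@A_omega (part v)); first by rewrite subUset sub1set bv.
apply: clique_add => // y /setU1P[->|/setD1P[_ yS]]; first by rewrite e_sym.
by apply: (tight_complete ti _ bA _ yS); rewrite bl.
Qed.

Lemma leaf_not_tight i l f : 1 < s -> tight i -> leaf i l f -> ~~ tight l.
Proof.
move=> s2 ti lf; apply/negP => tl; have il := leaf_neq lf.
have [g lg] := leaf_sym ti tl lf; have li := leaf_neq lg.
have efg := leaf_pair_nonadj ti tl lf lg.
have [S0 [n0 n0']] := A_avoids il.
have [v [vS fv fy]] := leaf_nonadj ti lf n0.
have [w [wS gw gy]] := leaf_nonadj tl lg n0'.
have [S0i cS0 S0s S0l] := n0; have [S0A _ _ S0i'] := n0'.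
(* If [v] and [w] lie in the same part, [1 < s] supplies another vertex of [S0] for the second
   index. *)
have [h [h' [hh [hi hl] [hi' hl'] hv hw]]] : exists h h', [/\ h != h',
    (h != i) /\ (h != l), (h' != i) /\ (h' != l), part v \in [:: h; h']
    & part w \in [:: h; h']].
  have [vw|vw] := eqVneq (part v) (part w); last first.
    exists (part v), (part w); rewrite !inE !eqxx orbT vw.
    by split=> //; split; rewrite ?S0l ?S0i'.
  have : 0 < #|S0 :\ v|.
    by move: S0s s2; rewrite (cardsD1 v) vS; move: #|_|; clear; lia.
  case/card_gt0P => u /setD1P[uv uS].
  exists (part v), (part u); rewrite !inE vw !eqxx; split=> //.
  - rewrite -vw eq_sym; apply: contra uv => /eqP pu.
    by apply/eqP; apply: (clique_part_inj e_part cS0).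
  - by split; rewrite ?S0l ?S0i'.
  - by split; rewrite ?S0l ?S0i'.
have [Q [nQ nQ']] := A_avoids hh; have [QA cQ Qs _] := nQ; have [QA' _ _ _] := nQ'.
have ih : i != h by rewrite eq_sym.
have ih' : i != h' by rewrite eq_sym.
have lh : l != h by rewrite eq_sym.
have lh' : l != h' by rewrite eq_sym.
have [a aQ ai] := avoids_part nQ hh ih ih'.
have [b bQ bl] := avoids_part nQ hh lh lh'.
have QAx x : part x \in [:: h; h'] -> Q \subset A (part x).
  by rewrite !inE => /orP[/eqP->|/eqP->].
have ab : a != b by apply: contraNneq il => ab; rewrite -ai ab bl.
have eab := cQ a b aQ bQ ab.
have [fA fl fu] := lf; have [gA gi gu] := lg.
have bN : b != f -> b \notin A i.
  by move=> bf; apply/negP => bA; case/eqP: bf; apply: fu.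
have aN : a != g -> a \notin A l.
  by move=> ag; apply/negP => aA; case/eqP: ag; apply: gu.
(* The edge [a b] joins parts [i] and [l]. The non-adjacency lemmas exclude [a = g] and [b = f];
   otherwise both ends are joined to [S0], giving a clique of size [s + 2]. *)
have [ag|ag] := eqVneq a g; have [bf|bf] := eqVneq b f.
- by move: efg; rewrite -ag -bf e_sym eab.
- have := leaf_cross_nonadj ti tl lg n0 n0' wS gy bl (bN bf).
  by rewrite -ag eab; move=> /(_ (subsetP (QAx _ hw) _ bQ)).
- have := leaf_cross_nonadj tl ti lf n0' n0 vS fy ai (aN ag).
  by rewrite -bf e_sym eab; move=> /(_ (subsetP (QAx _ hv) _ aQ)).
have bi : part b != i by rewrite bl.
have al : part a != l by rewrite ai.
have nb : avoids i (part b) S0 by rewrite bl.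
have na : avoids l (part a) S0 by rewrite ai.
have bS := tight_complete ti bi (bN bf) nb.
have aS := tight_complete tl al (aN ag) na.
have aS0 : a \notin S0 by apply/negP => /S0i'; rewrite ai eqxx.
have bS0 : b \notin S0 by apply/negP => /S0l; rewrite bl eqxx.
have : #|a |: (b |: S0)| <= s.+1; last first.
  by rewrite !cardsU1 !inE negb_or ab aS0 bS0 S0s !add1n ltnn.
apply: e_omega; apply: clique_add => //; first exact: clique_add.
by move=> y /setU1P[->|/aS].
Qed.

(** * Counting the indices that are not tight *)

Definition leaves i := [set l | (l != i) && (#|[set y in A i | part y == l]| == 1)].

Lemma leavesP i l : l \in leaves i -> exists f, leaf i l f.
Proof.
rewrite inE => /andP[li /cards1P[f Ef]].
have : f \in [set y in A i | part y == l] by rewrite Ef set11.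
rewrite inE => /andP[fA /eqP fl]; exists f; split=> // y yA yl.
by apply/set1P; rewrite -Ef inE yA yl eqxx.
Qed.

(** The [2 * s] vertices of [A i] occupy all [s + 1] other parts, so at least two parts receive just
    one. *)
Lemma card_leaves i : 0 < s -> tight i -> 2 <= #|leaves i|.
Proof.
move=> s0 ti; pose c l := #|[set y in A i | part y == l]|.
have sumc : \sum_(l | l != i) c l = 2 * s.
  rewrite -(eqP ti) -sum1_card (partition_big part (fun l => l != i)) /=; last first.
    by move=> y /A_part.
  apply: eq_bigr => l _; rewrite /c -sum1_card.
  by apply: eq_bigl => y; rewrite inE.
have cpos l : l != i -> 0 < c l.
  move=> li; have : 0 < #|[set~ i] :\ l|.
    by move: (cardsD1 l [set~ i]); rewrite cardsC1 card_ord !inE li; move: ks s0 #|_|; clear; lia.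
  case/card_gt0P => j; rewrite !inE => /andP[jl ji].
  have ij : i != j by rewrite eq_sym.
  have lj : l != j by rewrite eq_sym.
  have [S [nS _]] := A_avoids ij; have [y yS yl] := avoids_part nS ij li lj.
  apply/card_gt0P; exists y; rewrite inE yl eqxx andbT.
  by case: nS => /subsetP->.
have : \sum_(l | l != i) 2 <= \sum_(l | l != i) (c l + (l \in leaves i)).
  apply: leq_sum => l li; have := cpos l li; rewrite inE li /= -/(c l).
  by case: (c l) => [|[|n]].
rewrite big_split /= sumc sum_nat_const.
have -> : #|(fun l => l != i)| = s.+1.
  rewrite -(_ : #|[set~ i]| = s.+1); last by rewrite cardsC1 card_ord ks.
  by apply: eq_card => j; rewrite !inE.
have -> : \sum_(l | l != i) (l \in leaves i : nat) = #|leaves i|.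
  rewrite -sum1_card big_mkcond [RHS]big_mkcond; apply: eq_bigr => l _.
  by rewrite inE; case: (l != i) => //=; case: (_ == _).
by move: #|leaves i|; clear; lia.
Qed.

Lemma card_nontight : 1 < s -> 2 <= #|[set l | ~~ tight l]|.
Proof.
move=> s2; have [/existsP[i ti]|/existsPn no] := boolP [exists i, tight i].
  apply: leq_trans (card_leaves (ltnW s2) ti) _.
  apply/subset_leq_card/subsetP => l /leavesP[f lf].
  by rewrite inE (leaf_not_tight s2 ti lf).
rewrite (_ : [set l | ~~ tight l] = setT); last by apply/setP=> l; rewrite !inE no.
by rewrite cardsT card_ord; move: ks; clear; lia.
Qed.

Lemma sum_degree_nontight :
  k * (2 * s) + #|[set l | ~~ tight l]| <= \sum_i #|A i|.
Proof.
have -> : k * (2 * s) + #|[set l | ~~ tight l]|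
  = \sum_i (2 * s + (i \in [set l | ~~ tight l])).
  by rewrite big_split /= sum_nat_const card_ord -card_sum_mem.
apply: leq_sum => i _; rewrite inE.
have [j ij] : exists j, i != j.
  have : 0 < #|[set~ i]| by rewrite cardsC1 card_ord; move: ks; clear; lia.
  by case/card_gt0P => j; rewrite !inE eq_sym; exists j.
have := degree_ge ij; rewrite /tight eq_sym.
by case: ltngtP => //= [lt|<-] _; rewrite ?addn0 ?addn1.
Qed.

(** With only two indices not tight, they are the leaves of each of the three tight ones, and the
    leaf [f] in part [l] is common to these. Each tight [A i] has a unique non-neighbour of [f]
    outside part [l], lying in a tight part, and it belongs to every tight [A h] with [h] not its
    part. Two such vertices in different parts then meet in one [A h]. *)
Lemma card_nontight_five : s = 3 -> 3 <= #|[set l | ~~ tight l]|.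
Proof.
move=> s3; set B := [set l | _]; have s2 : 1 < s by rewrite s3.
have := card_nontight s2; rewrite -/B leq_eqVlt => /orP[/eqP B2|//].
have /cards2P[l [l' [ll' EB]]] : #|B| == 2 by rewrite -B2.
have tB i : (i \in B) = ~~ tight i by rewrite inE.
have leafB i : tight i -> leaves i = B.
  move=> ti; apply/eqP; rewrite eqEcard -B2 (card_leaves (ltnW s2) ti) andbT.
  apply/subsetP => j /leavesP[f lf].
  by rewrite inE (leaf_not_tight s2 ti lf).
have tl : ~~ tight l by rewrite -tB EB set21.
have cB : #|~: B| = 3.
  by move: (cardsC B); rewrite card_ord -B2; move: ks #|_|; rewrite s3; clear; lia.
have [i0 ti0] : exists i, tight i.
  have : 0 < #|~: B| by rewrite cB.
  by case/card_gt0P => i; rewrite inE tB negbK; exists i.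
have lB i : tight i -> forall j, j \in B -> exists f, leaf i j f.
  by move=> ti j; rewrite -(leafB i ti) => /leavesP.
have lBl : l \in B by rewrite EB set21.
have lBl' : l' \in B by rewrite EB set22.
have [f lf0] := lB i0 ti0 l lBl.
have fl i : tight i -> leaf i l f.
  move=> ti; have il : i != l by apply: contraNneq tl => <-.
  have [g lg] := lB i ti l lBl; have fA := leaf_full lf0 il.
  by have [_ fp _] := lf0; have [_ _ /(_ f fA fp) ->] := lg.
have third p p' : exists h, [/\ tight h, h != p & h != p'].
  have : 0 < #|~: B :\: [set p; p']|.
    rewrite cardsD cB; have := subset_leq_card (subsetIr (~: B) [set p; p']).
    rewrite cards2; move: #|_ :&: _|; case: (_ != _); clear; lia.
  case/card_gt0P => h; rewrite !inE negbK negb_or => /andP[/andP[hp hp'] th].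
  by exists h.
have nadj i : tight i -> exists v, [/\ v \in A i, tight (part v), part v != i,
    ~~ e f v & forall y, y \in A i -> part y != l -> ~~ e f y -> y = v].
  move=> ti; have lf := fl i ti; have il := leaf_neq lf.
  have [S [nS _]] := A_avoids il; have [SA cS Ss Sl] := nS.
  have [v [vS fv fy]] := leaf_nonadj ti lf nS.
  have vA := subsetP SA _ vS; have vi := A_part vA; have vl := Sl v vS.
  exists v; split=> //; last first.
    move=> y yA yl fNy; apply/eqP; apply: contraNT fNy; apply: fy => //.
    by apply: contraNneq yl => ->; case: lf => _ ->.
  rewrite -[tight _]negbK -tB EB !inE (negbTE vl) /=; apply/negP => /eqP vl'.
  have [f' lf'] := lB i ti l' lBl'; have vf' : v = f' by case: lf' => _ _; apply.
  have [h [th hi _]] := third i i; have ih : i != h by rewrite eq_sym.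
  have hl : h != l by apply: contraNneq tl => <-.
  have hl' : h != l' by apply: contraTneq th => ->; rewrite -tB.
  have [T [nT _]] := A_avoids ih; have [_ cT _ _] := nT.
  case/negP: fv; rewrite vf'; apply: cT.
  - exact: leaf_mem lf ih hl nT.
  - exact: leaf_mem lf' ih hl' nT.
  - apply: contraNneq ll' => ff'; case: lf => _ <- _; case: lf' => _ <- _.
    by rewrite ff'.
have spread y h : ~~ e f y -> tight (part y) -> tight h -> h != part y -> y \in A h.
  move=> fNy ty th hy; apply: contraT => yA; have yh : part y != h by rewrite eq_sym.
  have [T [nT _]] := A_avoids hy.
  have yl : part y != l by apply: contraNneq tl => <-.
  have := tight_complete th yh yA nT (leaf_mem (fl h th) hy yl nT).
  by rewrite e_sym (negbTE fNy).
have [y [yA ty yi fNy _]] := nadj i0 ti0.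
have [y' [y'A ty' y'p fNy' _]] := nadj _ ty.
have [h [th hp hp']] := third (part y) (part y').
have [v [_ _ _ _ vu]] := nadj h th.
have yl : part y != l by apply: contraNneq tl => <-.
have y'l : part y' != l by apply: contraNneq tl => <-.
have yv := vu y (spread _ _ fNy ty th hp) yl fNy.
have y'v := vu y' (spread _ _ fNy' ty' th hp') y'l fNy'.
by move: y'p; rewrite yv y'v eqxx.
Qed.

End Frame.

(** * Lower bounds *)

Lemma subset_of_card (T : finType) (S : {set T}) n :
  n <= #|S| -> exists2 S' : {set T}, S' \subset S & #|S'| = n.
Proof.
move=> nS; exists [set x in take n (enum S)].
  by apply/subsetP => x; rewrite inE => /mem_take; rewrite mem_enum.
rewrite cardsE (card_uniqP _) ?take_uniq ?enum_uniq //.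
by rewrite size_takel // -cardE.
Qed.

Lemma clique_le (V : finType) (e : rel V) r (S : {set V}) :
  ~ contains_K r.+1 e -> clique e S -> #|S| <= r.
Proof.
move=> noK cS; rewrite leqNgt; apply/negP => /subset_of_card[T TS Tr].
by apply: noK; exists T => //; apply: clique_sub cS.
Qed.

(** The new clique must use both [u] and [v]; the rest of it is [T]. *)
Lemma add_edge_common (V : finType) (e : rel V) s u v :
  symmetric e -> u != v -> ~ contains_K s.+2 e ->
  contains_K s.+2 (add_edge e u v) ->
  exists T : {set V}, [/\ clique e T, #|T| = s, {in T, forall y, e u y}
                        & {in T, forall y, e v y}].
Proof.
move=> es uv noK [S Ss cS].
have keep (x : V) : (x == u) || (x == v) -> x \in S.
  move=> xuv; apply: contraT => xS; case: noK; exists S => // y z yS zS yz.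
  have /or3P[//|/andP[/eqP yu /eqP zv]|/andP[/eqP yv /eqP zu]] := cS y z yS zS yz.
    by case/orP: xuv => /eqP xe; move: xS; rewrite xe -?yu -?zv ?yS ?zS.
  by case/orP: xuv => /eqP xe; move: xS; rewrite xe -?yv -?zu ?yS ?zS.
have uS : u \in S by apply: keep; rewrite eqxx.
have vS : v \in S by apply: keep; rewrite eqxx orbT.
have vSu : v \in S :\ u by rewrite !inE eq_sym uv.
exists (S :\ u :\ v); split.
- move=> y z; rewrite !inE => /and3P[yv yu yS] /and3P[zv zu zS] yz.
  by have := cS y z yS zS yz; rewrite /add_edge (negbTE yu) (negbTE yv) !orbF.
- have := cardsD1 v (S :\ u); have := cardsD1 u S.
  by rewrite uS vSu Ss !add1n => -[<-] [<-].
- move=> y; rewrite !inE => /and3P[yv yu yS].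
  have := cS u y uS yS; rewrite eq_sym yu /add_edge eqxx (negbTE yv) (negbTE yu).
  by rewrite !andbF !orbF => ->.
- move=> y; rewrite !inE => /and3P[yv yu yS].
  have := cS v y vS yS; rewrite eq_sym yv /add_edge eqxx (negbTE yv) (negbTE yu).
  by rewrite !andbF !orbF => ->.
Qed.

(** As [X] is independent, every edge at [X] leaves it, so the cut is the degree sum. *)
Lemma cut_sizeE (V : finType) (k : nat) (e : rel V) (X : {set V}) (x : 'I_k -> V) :
  injective x -> X = [set x i | i : 'I_k] -> independent e X ->
  cut_size e X = \sum_i #|[set y | e (x i) y]|.
Proof.
move=> xI EX indX; rewrite /cut_size -sum1_card.
rewrite (eq_bigl (fun p : V * V => (p.1 \in X) && e p.1 p.2)); last first.
  move=> p; rewrite inE; case p1: (p.1 \in X) => //=.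
  case p2: (p.2 \in X) => //=; symmetry; apply/negbTE; exact: indX.
rewrite -(pair_big_dep (mem X) (fun u v => e u v) (fun _ _ => 1)) /= EX.
rewrite big_imset /=; last by move=> i j _ _; apply: xI.
by apply: eq_bigr => i _; rewrite sum1dep_card.
Qed.

Lemma alpha_value_frame k s n : alpha_value k s.+2 n ->
  exists (V : finType) (part : V -> 'I_k) (e : rel V) (A : 'I_k -> {set V}),
  [/\ symmetric e, partite part e,
      forall S : {set V}, clique e S -> #|S| <= s.+1
    & n = \sum_i #|A i|] /\
  [/\ forall i y, y \in A i -> part y != i,
      forall i (S : {set V}), S \subset A i -> clique e S -> #|S| <= s,
      forall i j, i != j -> exists S : {set V},
        [/\ S \subset A i, S \subset A j, clique e S & #|S| = s]
    & forall i y, part y != i -> y \notin A i -> exists S : {set V},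
        [/\ S \subset A i, {in S, forall z, e y z}, clique e S & #|S| = s]].
Proof.
move=> [V [part [e [X [[es ei] ep [noK sat] [indX [Xk Xt]] cut]]]]].
have /choice[x Ex] : forall i, exists x, [set y in X | part y == i] = [set x].
  by move=> i; have /eqP/cards1P := Xt i.
have xX i : x i \in X /\ part (x i) = i.
  have : x i \in [set y in X | part y == i] by rewrite Ex set11.
  by rewrite inE => /andP[? /eqP].
have xI : injective x by move=> i j xij; rewrite -(xX i).2 xij (xX j).2.
have EX : X = [set x i | i : 'I_k].
  apply/setP => y; apply/idP/imsetP => [yX|[i _ ->]]; last by case: (xX i).
  exists (part y) => //; apply/set1P; rewrite -Ex inE yX eqxx //.
pose A i := [set y | e (x i) y].
have e_omega S : clique e S -> #|S| <= s.+1 by apply: clique_le.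
exists V, part, e, A; do 2!split=> //.
- by rewrite -cut (cut_sizeE xI EX indX).
- by move=> i y; rewrite inE => /ep; rewrite (xX i).2 eq_sym.
- move=> i S SA cS.
  have xS : x i \notin S by apply/negP => /(subsetP SA); rewrite inE ei.
  have := e_omega (x i |: S); rewrite cardsU1 xS add1n ltnS; apply.
  by apply: clique_add => // y /(subsetP SA); rewrite inE.
- move=> i j ij; have xij : x i != x j by apply: contraNneq ij => /xI->.
  have [||T [cT Ts Ti Tj]] := add_edge_common es xij noK (sat _ _ _ _).
  + by rewrite !(proj2 (xX _)).
  + by apply: indX; case: (xX i); case: (xX j).
  by exists T; split=> //; apply/subsetP => y; rewrite inE; [move/Ti|move/Tj].
- move=> i y yi; rewrite inE => yA.
  have xy : y != x i by apply: contraNneq yi => ->; rewrite (xX i).2.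
  have [||T [cT Ts Ti Tj]] := add_edge_common es xy noK (sat _ _ _ _).
  + by rewrite (xX i).2.
  + by rewrite es.
  by exists T; split=> //; apply/subsetP => z; rewrite inE; move/Tj.
Qed.

Lemma alpha_value_ge k s n : 2 <= k -> alpha_value k s.+2 n -> k * (2 * s) <= n.
Proof.
move=> k2 /alpha_value_frame[V [part [e [A [[es ep eo ->] [Ap Ao A2 As]]]]]].
rewrite -[k in leqLHS]card_ord -sum_nat_const; apply: leq_sum => i _.
have [j ij] : exists j, i != j.
  have : 0 < #|[set~ i]| by rewrite cardsC1 card_ord; move: k2; clear; lia.
  by case/card_gt0P => j; rewrite !inE eq_sym; exists j.
exact: (degree_ge es Ap Ao A2 ij).
Qed.

Lemma alpha_value_triangle_ge k n : alpha_value k 3 n -> 3 * (k - 1) <= n.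
Proof.
move=> /alpha_value_frame[V [part [e [A [[es ep eo ->] [Ap Ao A2 As]]]]]].
exact: sum_degree_triangle es ep Ap Ao A2 As _.
Qed.

Lemma alpha_value_diag_ge s n : 1 < s -> alpha_value s.+2 s.+2 n ->
  s.+2 * (2 * s) + 2 <= n.
Proof.
move=> s2 /alpha_value_frame[V [part [e [A [[es ep eo ->] [Ap Ao A2 As]]]]]].
apply: leq_trans (sum_degree_nontight es Ap Ao A2 _) => //.
by rewrite leq_add2l (card_nontight es ep eo Ap Ao A2 As).
Qed.

Lemma alpha_value_five_ge n : alpha_value 5 5 n -> 33 <= n.
Proof.
move=> /alpha_value_frame[V [part [e [A [[es ep eo ->] [Ap Ao A2 As]]]]]].
apply: leq_trans (sum_degree_nontight es Ap Ao A2 _) => //.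
by rewrite (@leq_add 30 3) // (card_nontight_five es ep eo Ap Ao A2 As).
Qed.

(** * Saturating a construction *)

Lemma contains_K_sub (V : finType) (e e' : rel V) r :
  subrel e e' -> contains_K r e -> contains_K r e'.
Proof.
by move=> ee' [S Sr cS]; exists S => // u v uS vS uv; apply/ee'/cS.
Qed.

Lemma add_edge_contains (V : finType) (e : rel V) s u v (T : {set V}) :
  symmetric e -> irreflexive e -> u != v -> clique e T -> #|T| = s ->
  {in T, forall y, e u y} -> {in T, forall y, e v y} ->
  contains_K s.+2 (add_edge e u v).
Proof.
move=> es ei uv cT Ts Tu Tv; exists (u |: (v |: T)).
  have uT : u \notin T by apply/negP => /Tu; rewrite ei.
  have vT : v \notin T by apply/negP => /Tv; rewrite ei.
  by rewrite !cardsU1 !inE negb_or uv uT vT Ts.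
move=> y z /setU1P[->|/setU1P[->|yT]] /setU1P[->|/setU1P[->|zT]] yz;
  rewrite /add_edge ?eqxx ?orbT //.
- by move: yz; rewrite eqxx.
- by rewrite Tu.
- by move: yz; rewrite eqxx.
- by rewrite Tv.
- by rewrite es Tu.
- by rewrite es Tv.
- by rewrite cT.
Qed.

(** Take a maximal [K_r]-free extension unchanged at [X]. Non-edges meeting [X] stay saturated in a
    larger graph, and any other one is saturated by maximality. *)
Lemma saturate (k r : nat) (V : finType) (part : V -> 'I_k) (e : rel V)
    (X : {set V}) :
  symmetric e -> partite part e -> ~ contains_K r e ->
  (forall u v, u \in X -> part u != part v -> ~~ e u v ->
     contains_K r (add_edge e u v)) ->
  exists e' : rel V, [/\ symmetric e', partite part e',
    partite_saturated r part e'
    & forall u v, (u \in X) || (v \in X) -> e' u v = e u v].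
Proof.
move=> es ep noK satX.
(* Relations are coded as sets of ordered pairs so that [ex_maxset] applies. *)
pose R (E : {set V * V}) : rel V := fun u v => (u, v) \in E.
pose P E := `[< [/\ symmetric (R E), partite part (R E), ~ contains_K r (R E),
  subrel e (R E) & forall u v, (u \in X) || (v \in X) -> R E u v = e u v] >].
have exP : exists E, P E.
  exists [set p | e p.1 p.2]; apply/asboolP.
  have RE u v : R [set p | e p.1 p.2] u v = e u v by rewrite /R inE.
  split=> [u v|u v|||u v _]; rewrite ?RE //.
  - exact: ep.
  - by move=> cK; apply: noK; apply: contains_K_sub cK => u v; rewrite RE.
  - by move=> u v; rewrite RE.
have [E /maxsetP[/asboolP[Es Ep EnoK eE EX] Emax]] := ex_maxset exP.
exists (R E); split=> //; split=> // u v uv nuv.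
have mono (e1 e2 : rel V) a b : subrel e1 e2 ->
    subrel (add_edge e1 a b) (add_edge e2 a b).
  by move=> ee' x y /or3P[/ee'|xy|xy]; rewrite /add_edge ?xy ?orbT // => ->.
have [uX|uX] := boolP (u \in X).
  by apply: contains_K_sub (mono _ _ _ _ eE) (satX u v uX uv _); rewrite -EX ?uX.
have [vX|vX] := boolP (v \in X).
  have vu : contains_K r (add_edge e v u).
    by apply: satX => //; [rewrite eq_sym|rewrite es -EX ?vX ?orbT].
  apply: contains_K_sub vu => x y /or3P[/eE xy|xy|xy].
  - by rewrite /add_edge xy.
  - by rewrite /add_edge xy !orbT.
  - by rewrite /add_edge xy !orbT.
apply: contrapT => noK'; case/negP: nuv.
have <- : (u, v) |: ((v, u) |: E) = E; last by rewrite /R setU11.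
have RE x y : R ((u, v) |: ((v, u) |: E)) x y = add_edge (R E) u v x y.
  by rewrite /R /add_edge !inE !xpair_eqE orbA orbC.
apply: Emax; last by apply/subsetP => x xE; rewrite !inE xE !orbT.
apply/asboolP; split.
- move=> x y; rewrite !RE /add_edge Es; congr (_ || _).
  by rewrite orbC; congr (_ || _); rewrite andbC.
- move=> x y; rewrite RE => /or3P[/Ep//|/andP[/eqP-> /eqP->]|/andP[/eqP-> /eqP->]] //.
  by rewrite eq_sym.
- by move=> cK; apply: noK'; apply: contains_K_sub cK => x y; rewrite RE.
- by move=> x y /eE; rewrite RE /add_edge => ->.
- move=> x y xy; rewrite RE /add_edge EX //.
  suff -> : (x == u) && (y == v) || (x == v) && (y == u) = false by rewrite orbF.
  apply/negP => /orP[]/andP[/eqP xe /eqP ye]; move: xy;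
    by rewrite xe ye (negbTE uX) (negbTE vX).
Qed.

Section Construction.
Variables (k s : nat) (Y : finType) (p : Y -> 'I_k) (h : rel Y).
Variable N : 'I_k -> {set Y}.

(** [inl i] is the transversal vertex of part [i], with neighbourhood [N i] in the core [Y]. *)
Definition join_part (u : 'I_k + Y) : 'I_k :=
  match u with inl i => i | inr y => p y end.

Definition join_rel (u v : 'I_k + Y) : bool :=
  match u, v with
  | inl _, inl _ => false
  | inl i, inr y | inr y, inl i => y \in N i
  | inr y, inr z => h y z
  end.

Lemma construction :
  symmetric h -> partite p h ->
  (forall S : {set Y}, clique h S -> #|S| <= s.+1) ->
  (forall i y, y \in N i -> p y != i) ->
  (forall i (S : {set Y}), S \subset N i -> clique h S -> #|S| <= s) ->
  (forall i j, i != j -> exists S : {set Y},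
     [/\ S \subset N i, S \subset N j, clique h S & #|S| = s]) ->
  (forall i y, p y != i -> y \notin N i -> exists S : {set Y},
     [/\ S \subset N i, {in S, forall z, h y z}, clique h S & #|S| = s]) ->
  alpha_value k s.+2 (\sum_i #|N i|).
Proof.
move=> hs hp h_omega Np N_omega N2 Nsat.
have es : symmetric join_rel by move=> [i|y] [j|z] //=.
have ep : partite join_part join_rel.
  move=> [i|y] [j|z] //=; [move/Np|move/Np|exact: hp] => //; by rewrite eq_sym.
have ei : irreflexive join_rel.
  by move=> u; apply/negP => /ep; rewrite eqxx.
have pull (S : {set 'I_k + Y}) : clique join_rel S ->
    clique h [set y | inr y \in S].
  by move=> cS y z; rewrite !inE => yS zS yz; apply: (cS (inr y) (inr z)).
have push (S : {set Y}) : clique h S -> clique join_rel (@inr 'I_k Y @: S).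
  move=> cS _ _ /imsetP[y yS ->] /imsetP[z zS ->] yz; exact: cS.
have cpush (S : {set Y}) : #|@inr 'I_k Y @: S| = #|S|.
  by apply: card_imset => y z [].
pose X := [set @inl 'I_k Y i | i : 'I_k].
have inX i : inl i \in X by apply: imset_f.
have [|u v uX uv nuv|e' [e's e'p sat e'e]] :=
  @saturate k s.+2 _ join_part join_rel X es ep.
- case=> S Ss cS; pose J := [set i | inl i \in S].
  have : #|S| = #|J| + #|[set y | inr y \in S]|.
    by rewrite -!sum1_card big_sumType /=; congr (_ + _); apply: eq_bigl => x; rewrite inE.
  have J1 : #|J| <= 1.
    rewrite leqNgt; apply/negP => /card_gt1P[i [j []]]; rewrite !inE => iS jS ij.
    have nij : inl i != inl j :> 'I_k + Y by apply: contraNneq ij => -[->].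
    by have := cS _ _ iS jS nij.
  have [E0|/set0Pn[i]] := eqVneq J set0.
    by rewrite E0 cards0 add0n Ss => E; have := h_omega _ (pull _ cS); rewrite -E ltnn.
  rewrite inE => iS; have := fun sub => N_omega i _ sub (pull _ cS).
  move=> H E; have : #|[set y | inr y \in S]| <= s.
    apply: H; apply/subsetP => y; rewrite inE => yS.
    exact: (cS _ _ iS yS).
  by move: J1 E; rewrite Ss; move: #|J| #|_|; clear; lia.
- case/imsetP: uX uv nuv => i _ ->; case: v => [j|y] /= uv nuv.
    have [S [Si Sj cS Ss]] := N2 i j uv.
    apply: (add_edge_contains es ei _ (push S cS)).
    + by apply: contraNneq uv => -[->].
    + by rewrite cpush.
    + by move=> _ /imsetP[y yS ->]; apply: (subsetP Si).
    + by move=> _ /imsetP[y yS ->]; apply: (subsetP Sj).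
  have [|S [Si Sy cS Ss]] := Nsat i y _ nuv; first by rewrite eq_sym.
  apply: (add_edge_contains es ei _ (push S cS)) => //.
  + by rewrite cpush.
  + by move=> _ /imsetP[z zS ->]; apply: (subsetP Si).
  + by move=> _ /imsetP[z zS ->]; apply: Sy.
exists ('I_k + Y)%type, join_part, e', X; split=> //.
- by split=> // u; apply/negP => /e'p; rewrite eqxx.
- split.
    by move=> _ _ /imsetP[i _ ->] /imsetP[j _ ->]; rewrite e'e ?inX.
  split; first by rewrite card_imset ?card_ord // => i j [].
  move=> i; rewrite (_ : [set x in X | _] = [set inl i]) ?cards1 //.
  apply/setP => u; rewrite !inE; apply/andP/eqP => [[]|->]; last by rewrite inX eqxx.
  by case/imsetP => j _ -> /= /eqP->.
rewrite (@cut_sizeE _ k e' X inl) //; first last.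
- by move=> _ _ /imsetP[i _ ->] /imsetP[j _ ->]; rewrite e'e ?inX.
- by move=> i j [].
apply: eq_bigr => i _; rewrite -cpush; apply: eq_card => -[j|y]; rewrite inE e'e ?inX //=.
  by symmetry; apply/negbTE/negP => /imsetP[].
by rewrite mem_imset // => y1 y2 [].
Qed.

End Construction.

(** * Upper bounds *)

(* The hypotheses of [construction] when every [x_i] is joined to all of [Y]
   outside part [i], so that nothing is required of the pairs [x_i], [y]. *)
Definition complete_core (k s m : nat) : Prop :=
  exists (Y : finType) (p : Y -> nat) (h : rel Y),
  [/\ #|Y| = m, symmetric h, forall y z, h y z -> p y != p z
    & forall y, p y < k] /\
  [/\ forall S : {set Y}, clique h S -> #|S| <= s.+1,
      forall i (S : {set Y}), i < k -> clique h S ->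
        {in S, forall y, p y != i} -> #|S| <= s
    & forall i j, i != j -> exists S : {set Y},
        [/\ clique h S, #|S| = s, {in S, forall y, p y != i}
          & {in S, forall y, p y != j}]].

(** Each core vertex is joined to the [k - 1] transversal vertices outside its part. *)
Lemma alpha_value_complete_core k s m :
  complete_core k s m -> alpha_value k s.+2 ((k - 1) * m).
Proof.
case=> Y [p [h [[Ym hs hp pk] [h_omega hi hij]]]].
pose p' y := Ordinal (pk y); pose N (i : 'I_k) := [set y | p' y != i].
have -> : (k - 1) * m = \sum_i #|N i|.
  rewrite (eq_bigr _ (fun i _ => card_sum_mem (N i))) exchange_big /=.
  rewrite (eq_bigr (fun=> k - 1)) ?sum_nat_const ?Ym 1?mulnC // => y _.
  rewrite subn1 -[k in RHS]card_ord -(cardsC1 (p' y)) card_sum_mem.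
  by apply: eq_bigr => i _; rewrite !inE eq_sym.
have Np (i : 'I_k) (S : {set Y}) : {in S, forall y, p y != i} -> S \subset N i.
  by move=> Si; apply/subsetP => y /Si; rewrite inE -val_eqE.
apply: (@construction k s Y p' h) => //.
- by move=> i y; rewrite inE.
- move=> i S SN cS; apply: (hi i) => // y /(subsetP SN); by rewrite inE -val_eqE.
- move=> i j ij; have [|S [cS Ss Si Sj]] := hij i j; first by rewrite val_eqE.
  by exists S; split=> //; apply: Np.
- by move=> i y; rewrite inE => ->.
Qed.

(* Join a vertex of a new part to everything, and one vertex in each of the
   parts [0] and [1] to everything outside its part; the three new vertices are
   pairwise non-adjacent. *)
Lemma complete_core_step k s m :
  1 < k -> complete_core k s m -> complete_core k.+1 s.+1 (m + 3).
Proof.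
move=> k1 [Y [p [h [[Ym hs hp pk] [h_omega hi hij]]]]].
(* The new vertices 0, 1, 2 go to the parts [k], 0, 1. *)
pose q (c : 'I_3) := if val c is n.+1 then n else k.
pose p' (u : Y + 'I_3) := match u with inl y => p y | inr c => q c end.
pose h' (u v : Y + 'I_3) := match u, v with
  | inl y, inl z => h y z
  | inl y, inr c | inr c, inl y => p y != q c
  | inr _, inr _ => false
  end.
have qk c : q c < k.+1.
  rewrite /q; case: c => [[|[|[|//]]] ?] //=; by move: k1; clear; lia.
have pull (S : {set Y + 'I_3}) : clique h' S -> clique h [set y | inl y \in S].
  by move=> cS y z; rewrite !inE => yS zS yz; apply: (cS (inl y) (inl z)).
have cardS (S : {set Y + 'I_3}) :
    #|S| = #|[set y | inl y \in S]| + #|[set c | inr c \in S]|.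
  rewrite -!sum1_card big_sumType /=; congr (_ + _);
  by apply: eq_bigl => x; rewrite inE.
have C1 (S : {set Y + 'I_3}) : clique h' S -> #|[set c | inr c \in S]| <= 1.
  move=> cS; rewrite leqNgt; apply/negP => /card_gt1P[c [d []]].
  rewrite !inE => cS' dS cd.
  have ncd : inr c != inr d :> Y + 'I_3 by apply: contraNneq cd => -[->].
  by have := cS _ _ cS' dS ncd.
exists (Y + 'I_3)%type, p', h'; split; split.
- by rewrite card_sum Ym card_ord.
- by move=> [y|c] [z|d] //=.
- by move=> [y|c] [z|d] //=; [exact: hp|rewrite eq_sym].
- by move=> [y|c] /=; [apply: ltnW; apply: pk|apply: qk].
- by move=> S cS; rewrite cardS -[s.+2]addn1 leq_add ?C1 ?h_omega //; apply: pull.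
- move=> i S ik cS Si; rewrite cardS.
  have Ti : {in [set y | inl y \in S], forall y, p y != i}.
    by move=> y; rewrite inE => /Si.
  have [ik'|ki] := ltnP i k.
    by rewrite -[s.+1]addn1 leq_add ?C1 // (hi i) //; apply: pull.
  have {ki}ik : i = k by move: ik ki; clear; lia.
  have [->|/set0Pn[c]] := eqVneq [set c | inr c \in S] set0.
    by rewrite cards0 addn0 h_omega //; apply: pull.
  rewrite inE => cS'; rewrite -[s.+1]addn1 leq_add ?C1 //.
  have qc : q c < k.
    have := Si _ cS'; rewrite ik /=; have := qk c; clear; lia.
  apply: (hi (q c)) => //; first exact: pull.
  by move=> y; rewrite inE => yS; apply: (cS (inl y) (inr c) yS cS').
have ext c i j (S : {set Y}) : clique h S -> #|S| = s ->
    {in S, forall y, p y != q c} -> {in S, forall y, p y != i} ->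
    {in S, forall y, p y != j} -> q c != i -> q c != j ->
    exists S' : {set Y + 'I_3}, [/\ clique h' S', #|S'| = s.+1,
      {in S', forall u, p' u != i} & {in S', forall u, p' u != j}].
  move=> cS Ss Sc Si Sj ci cj; exists (inr c |: (inl @: S)); split.
  - apply: clique_add => //; first by move=> [y|d] [z|b] //=.
      move=> _ _ /imsetP[y yS ->] /imsetP[z zS ->] yz; exact: cS.
    by move=> _ /imsetP[y yS ->]; apply: Sc.
  - rewrite cardsU1 (_ : _ \notin _ = true) ?card_imset ?Ss //.
      by move=> y z [].
    by apply/negP => /imsetP[].
  - by move=> u /setU1P[->|/imsetP[y yS ->]] //=; apply: Si.
  - by move=> u /setU1P[->|/imsetP[y yS ->]] //=; apply: Sj.
have pk' y : p y != k by rewrite neq_ltn pk.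
have new j : j != k -> exists S' : {set Y + 'I_3}, [/\ clique h' S',
    #|S'| = s.+1, {in S', forall u, p' u != k} & {in S', forall u, p' u != j}].
  (* One of the parts 0 and 1 differs from [j], and its new vertex extends the old clique. *)
  move=> jk; have [c [ck cj]] : exists c : 'I_3, q c != k /\ q c != j.
    have [->|j0] := eqVneq j 0.
      by exists (@Ordinal 3 2 isT) => /=; split=> //; rewrite neq_ltn k1.
    exists (@Ordinal 3 1 isT) => /=; split; last by rewrite eq_sym.
    by rewrite neq_ltn (ltnW k1).
  have [S [cS Ss Sc Sj]] := hij _ _ cj.
  by apply: (ext c k j S).
move=> i j ij; have [ik|ik] := eqVneq i k.
  by rewrite ik; apply: new; rewrite eq_sym -ik.
have [jk|jk] := eqVneq j k.
  by have [S [? ? ? ?]] := new i ik; exists S; rewrite jk.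
have [S [cS Ss Si Sj]] := hij i j ij.
by apply: (ext (@Ordinal 3 0 isT) i j S) => //; rewrite eq_sym.
Qed.

(** * Complements of cycles *)

Section Cycle.
Variable n : nat.

(* Complement of the cycle on [0, ..., n-1]. *)
Definition consecutive (i j : nat) : bool :=
  [|| j == i.+1, i == j.+1, (i == 0) && (j == n.-1) | (j == 0) && (i == n.-1)].

Definition cocycle : rel 'I_n := fun i j => (i != j) && ~~ consecutive i j.

(** Addition and, in [offset], subtraction modulo [n] for arguments below [n], written without [%%]
    to suit [lia]. *)
Definition rotate (u d : nat) : nat := if u + d < n then u + d else u + d - n.

Definition offset (u x : nat) : nat := if u <= x then x - u else x + n - u.

Lemma cocycle_sym : symmetric cocycle.
Proof.
move=> i j; rewrite /cocycle /consecutive eq_sym; congr (_ && ~~ _).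
by case: (j == i.+1 :> nat); case: (i == j.+1 :> nat) => //=; rewrite orbC.
Qed.

Lemma rotate_lt u d : u < n -> d < n -> rotate u d < n.
Proof. by rewrite /rotate; clear; case: ifP; lia. Qed.

Lemma offset_lt u x : u < n -> x < n -> offset u x < n.
Proof. by rewrite /offset; clear; case: ifP; lia. Qed.

Lemma rotate_far u d d' : u < n -> d < n -> d' < n -> d + 1 < d' -> d' < d + n.-1 ->
  (rotate u d != rotate u d') && ~~ consecutive (rotate u d) (rotate u d').
Proof. by rewrite /rotate /consecutive; clear; case: ifP; case: ifP; lia. Qed.

Lemma offset_inj u x y : u < n -> x < n -> y < n ->
  offset u x = offset u y -> x = y.
Proof. by rewrite /offset; clear; case: ifP; case: ifP; lia. Qed.

Lemma offset_succ u x y : u < n -> x < n -> y < n ->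
  offset u y = (offset u x).+1 -> consecutive x y.
Proof. by rewrite /offset /consecutive; clear; case: ifP; case: ifP; lia. Qed.

Lemma rotate_mod u d L : L %| n -> rotate u d = u + d %[mod L].
Proof.
move=> /dvdnP[c En]; rewrite /rotate; case: ltnP => // le.
by rewrite -[in RHS](subnKC le) [in X in _ = X + _ %[mod _]]En modnMDl.
Qed.

Lemma offset_mod u x L : L %| n -> u < n -> u + offset u x = x %[mod L].
Proof.
move=> /dvdnP[c En] un; rewrite /offset; case: leqP => [le|lt].
  by rewrite subnKC.
by rewrite subnKC; [rewrite addnC En modnMDl|move: un; clear; lia].
Qed.

(** A clique and its shift by one step of the cycle are disjoint. *)
Lemma cocycle_clique_bound (S : {set 'I_n}) :
  1 < n -> clique cocycle S -> 2 * #|S| <= n.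
Proof.
move=> n1 cS; have disj : S :&: (@ordS n @: S) = set0.
  apply/setP => y; rewrite !inE; apply/negP => /andP[yS /imsetP[x xS yx]].
  have vy : y = x.+1 %% n :> nat by rewrite yx.
  have [/(cS _ _ xS yS)|] := boolP (x != y).
    rewrite /cocycle /consecutive vy => /andP[_]; case: (ltnP x.+1 n) => xn.
      by rewrite modn_small // eqxx.
    have -> : x.+1 = n by apply/eqP; rewrite eqn_leq ltn_ord.
    by rewrite modnn -[n in n.-1](_ : x.+1 = n) ?eqxx ?orbT //;
      apply/eqP; rewrite eqn_leq ltn_ord.
  rewrite negbK -val_eqE /= vy; case: (ltnP x.+1 n) => xn.
    by rewrite modn_small // => /eqP; clear; lia.
  have xE : x.+1 = n by apply/eqP; rewrite eqn_leq ltn_ord.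
  by rewrite xE modnn => /eqP; move: xE n1; clear; lia.
have := cardsUI S (@ordS n @: S); rewrite disj cards0 addn0.
rewrite card_imset; last exact: ordS_inj.
have := max_card (S :|: @ordS n @: S); rewrite card_ord.
by move: #|_| #|_|; clear; lia.
Qed.

End Cycle.

Lemma card_le_inj (T : finType) (S : {set T}) (f : T -> nat) m :
  {in S, forall x, f x < m} -> {in S &, injective f} -> #|S| <= m.
Proof.
case: m => [|m] fm fI.
  by rewrite leqNgt; apply/negP => /card_gt0P[x /fm].
have gI : {in S &, injective (fun x => inord (f x) : 'I_m.+1)}.
  move=> x y xS yS /(congr1 val) /=; rewrite !inordK ?fm //; exact: fI.
by rewrite -(card_in_imset gI) -[leqRHS]card_ord max_card.
Qed.

(* The cycle of length [c * (2 * h + 1)] is cut by each residue class modulo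
   [2 * h + 1] into [c] paths with [2 * h] vertices. *)
Section Arcs.
Variables c h : nat.
Local Notation L := (2 * h + 1).
Local Notation n := (c * (2 * h + 1)).

(** Every second vertex is taken in each of the [c] paths left by the class of [u]; [eps b] chooses
    even instead of odd positions on path [b]. *)
Lemma arc_clique (u : nat) (eps : nat -> bool) : u < n ->
  exists S : {set 'I_n}, [/\ clique (@cocycle n) S, #|S| = c * h
    & forall x, x \in S -> exists b q, [/\ b < c, q < h
        & x = rotate n u (b * L + (2 * q + 1 + eps b)) :> nat]].
Proof.
move=> un; pose pos b q := b * L + (2 * q + 1 + eps b).
have pos_lt b q : b < c -> q < h -> pos b q < n.
  move=> bc qh; have : b.+1 * L <= c * L by rewrite leq_mul2r bc orbT.
  rewrite /pos mulSn; move: qh; case: (eps b); move: (b * L) n; clear; lia.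
have pos_gt0 b q : 0 < pos b q by rewrite /pos; case: (eps b); clear; lia.
have far b q b' q' : q < h -> q' < h -> (b, q) != (b', q') ->
    (pos b q + 1 < pos b' q') || (pos b' q' + 1 < pos b q).
  move=> qh q'h; rewrite /pos xpair_eqE.
  have [lt|lt|->] := ltngtP b b'.
  - have : b.+1 * L <= b' * L by rewrite leq_mul2r lt orbT.
    rewrite mulSn; move: qh q'h; move: (b * L) (b' * L).
    by case: (eps b); case: (eps b'); clear; lia.
  - have : b'.+1 * L <= b * L by rewrite leq_mul2r lt orbT.
    rewrite mulSn; move: qh q'h; move: (b * L) (b' * L).
    by case: (eps b); case: (eps b'); clear; lia.
  - by rewrite /=; move: (b' * L); case: (eps b'); clear; lia.
pose f (t : 'I_c * 'I_h) : 'I_n :=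
  Ordinal (rotate_lt un (pos_lt _ _ (ltn_ord t.1) (ltn_ord t.2))).
have lt_adj (t t' : 'I_c * 'I_h) : pos t.1 t.2 + 1 < pos t'.1 t'.2 -> cocycle (f t) (f t').
  move=> lt; have l1 := pos_lt _ _ (ltn_ord t.1) (ltn_ord t.2).
  have l2 := pos_lt _ _ (ltn_ord t'.1) (ltn_ord t'.2).
  have g1 := pos_gt0 t.1 t.2.
  apply: (rotate_far un l1 l2 lt).
  by move: l2 g1; move: (pos _ _) (pos _ _) n; clear; lia.
have adj (t t' : 'I_c * 'I_h) : t != t' -> cocycle (f t) (f t').
  case: t t' => [b q] [b' q'] tt'.
  have /orP[lt|lt] := @far b q b' q' (ltn_ord q) (ltn_ord q') tt'.
    exact: lt_adj.
  by rewrite cocycle_sym; apply: lt_adj.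
have fI : injective f.
  move=> t t' ftt'; apply/eqP; apply: contraT => /adj.
  by rewrite ftt' /cocycle eqxx.
exists (f @: setT); split.
- move=> _ _ /imsetP[t _ ->] /imsetP[t' _ ->] ntt'; apply: adj.
  by apply: contraNneq ntt' => ->.
- by rewrite card_imset // cardsT card_prod !card_ord.
- by move=> _ /imsetP[[b q] _ ->]; exists b, q.
Qed.

Lemma arc_residue u b q (eps : nat -> bool) :
  rotate n u (b * L + (2 * q + 1 + eps b)) = u + (2 * q + 1 + eps b) %[mod L].
Proof. by rewrite rotate_mod ?dvdn_mull // addnCA modnMDl. Qed.

Lemma residue_shift u o : 0 < o < L -> u + o != u %[mod L].
Proof.
move=> /andP[o0 oL]; rewrite -[X in _ != X %[mod _]]addn0 eqn_modDl mod0n.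
by rewrite modn_small // -lt0n.
Qed.

(** Odd positions after [u] miss the class of [w] when the offset from [u] to [w] modulo [L] is
    even. As [L] is odd, one of the two offsets is even, or both are 0. *)
Lemma arc_avoid2 u w : u < n -> w < n ->
  exists S : {set 'I_n}, [/\ clique (@cocycle n) S, #|S| = c * h,
    {in S, forall x : 'I_n, x != u %[mod L]}
    & {in S, forall x : 'I_n, x != w %[mod L]}].
Proof.
have main u' w' o : u' < n -> o < L -> ~~ odd o -> u' + o = w' %[mod L] ->
    exists S : {set 'I_n}, [/\ clique (@cocycle n) S, #|S| = c * h,
      {in S, forall x : 'I_n, x != u' %[mod L]}
      & {in S, forall x : 'I_n, x != w' %[mod L]}].
  move=> un oL oo uow; have [S [cS Ss Sx]] := arc_clique (fun=> false) un.
  exists S; split=> // x /Sx[b [q [bc qh ->]]].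
    by rewrite (arc_residue _ _ _ (fun=> false)) residue_shift //; move: qh; clear; lia.
  rewrite (arc_residue _ _ _ (fun=> false)) -uow eqn_modDl !modn_small //.
    by apply: contraNneq oo => <-; rewrite addn0 addn1 /= oddM.
  by move: qh; clear; lia.
move=> un wn; set o := offset n u w %% L.
have oL : o < L by rewrite ltn_pmod // addn1.
have uow : u + o = w %[mod L].
  by rewrite modnDmr offset_mod // dvdn_mull.
have [oo|oo] := boolP (odd o); last exact: main oo uow.
have [|||S [cS Ss Sw Su]] := main w u (L - o) wn.
- by move: oo; case: o oL {uow} => //= o _ _; rewrite ltn_subrL addn1.
- by rewrite oddB ?(ltnW oL) // oo addn1 /= oddM.
- by rewrite -modnDml -uow modnDml -addnA subnKC ?(ltnW oL) // modnDr.
by exists S.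
Qed.

(** Even positions on the first path miss the successor of [u], odd ones on the last path miss its
    predecessor; [1 < c] makes these paths distinct. *)
Lemma arc_avoid_neighbours (u : 'I_n) : 1 < c ->
  exists S : {set 'I_n}, [/\ clique (@cocycle n) S, #|S| = c * h,
    {in S, forall x : 'I_n, x != u %[mod L]}
    & {in S, forall x : 'I_n, cocycle u x}].
Proof.
move=> c1; have un := ltn_ord u.
have [S [cS Ss Sx]] := arc_clique (fun b => b == 0) un.
exists S; split=> // x /Sx[b [q [bc qh xE]]].
  rewrite xE (arc_residue _ _ _ (fun b => b == 0)) residue_shift //.
  by move: qh; case: (b == 0); clear; lia.
have n0 : 0 < n by apply: leq_ltn_trans un.
have := @rotate_far n u 0 (b * L + (2 * q + 1 + (b == 0))) un n0.
have -> : rotate n u 0 = u by rewrite /rotate addn0 un.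
rewrite -xE => H; apply: H.
- have : b.+1 * L <= c * L by rewrite leq_mul2r bc orbT.
  by rewrite mulSn; move: qh; case: (b == 0); move: (b * L) n; clear; lia.
- by case: b {bc xE} => [|b]; rewrite ?mulSn /=; move: qh; clear; lia.
case: b {xE} bc => [|b] bc.
  have : 2 * L <= c * L by rewrite leq_mul2r c1 orbT.
  by move: qh n; clear; lia.
have : b.+2 * L <= c * L by rewrite leq_mul2r bc orbT.
by rewrite !mulSn; move: qh n; clear; lia.
Qed.

(** Each path splits into [h] pairs of consecutive vertices, and a clique has at most one vertex in
    each; [d x %/ L * h + q x] numbers the pairs. *)
Lemma arc_clique_bound u (S : {set 'I_n}) : u < n -> clique (@cocycle n) S ->
  {in S, forall x : 'I_n, x != u %[mod L]} -> #|S| <= c * h.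
Proof.
move=> un cS Su; pose d (x : 'I_n) := offset n u x.
have dn x : d x < n by apply: offset_lt.
have d0 x : x \in S -> 0 < d x %% L.
  move=> xS; rewrite lt0n; apply: contra (Su x xS) => /eqP dx.
  by rewrite -(@offset_mod n u x) ?dvdn_mull // -modnDmr -/(d x) dx addn0.
pose q x := (d x %% L).-1 %/ 2.
have qh x : x \in S -> q x < h.
  move=> xS; rewrite ltn_divLR //; have := d0 x xS.
  have : d x %% L < L by rewrite ltn_pmod // addn1.
  by move: (_ %% _); clear; lia.
have dE x : d x = d x %/ L * L + d x %% L by apply: divn_eq.
apply: (card_le_inj (f := fun x => d x %/ L * h + q x)).
  move=> x xS; have bc : d x %/ L < c by rewrite ltn_divLR ?dn // addn1.
  have : (d x %/ L).+1 * h <= c * h by rewrite leq_mul2r bc orbT.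
  by rewrite mulSn; have := qh x xS; move: (_ * h) (c * h) (q x); clear; lia.
move=> x y xS yS exy; apply/eqP; apply: contraT => nxy.
have h0 : 0 < h by apply: leq_ltn_trans (qh x xS).
have eb : d x %/ L = d y %/ L.
  by have := congr1 (divn^~ h) exy; rewrite !divnMDl // !(divn_small (qh _ _)) // !addn0.
have eq : q x = q y by move: exy; rewrite eb => /addnI.
have /andP[_ /negP[]] := cS x y xS yS nxy.
have [lt|lt|eqd] := ltngtP (d x) (d y).
- apply: (offset_succ un) => //; rewrite -/(d x) -/(d y).
  move: eq lt (d0 x xS) (d0 y yS); rewrite (dE x) (dE y) eb /q.
  rewrite !modnMDl !modn_mod; move: (_ %/ L * L) (d x %% L) (d y %% L).
  by clear; lia.
- suff : consecutive n y x.
    by rewrite /consecutive => /or4P[]->; rewrite ?orbT.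
  apply: (offset_succ un) => //; rewrite -/(d x) -/(d y).
  move: eq lt (d0 x xS) (d0 y yS); rewrite (dE x) (dE y) eb /q.
  rewrite !modnMDl !modn_mod; move: (_ %/ L * L) (d x %% L) (d y %% L).
  by clear; lia.
- by move: nxy; rewrite (val_inj (offset_inj un _ _ eqd)) ?eqxx.
Qed.

End Arcs.

Lemma complete_core_cycle k s : 0 < s -> 2 * s + 1 <= k ->
  complete_core k s (2 * s + 1).
Proof.
move=> s0 sk; pose n := 1 * (2 * s + 1).
have nE : n = 2 * s + 1 by rewrite /n mul1n.
have n1 : 1 < n by rewrite nE; move: s0; clear; lia.
have bound (S : {set 'I_n}) : clique (@cocycle n) S -> #|S| <= s.
  move=> /(cocycle_clique_bound n1); rewrite [leqRHS]nE.
  by move: #|S|; clear; lia.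
exists 'I_n, val, (@cocycle n); split; split.
- by rewrite card_ord nE.
- exact: cocycle_sym.
- by move=> y z /andP[].
- by move=> y; apply: leq_trans sk; rewrite -nE ltn_ord.
- by move=> S /bound/leqW.
- by move=> i S _ /bound.
(* Parts beyond the cycle contain no core vertex, so any class, here that of 0, may replace them. *)
move=> i j _; pose u x := if x < n then x else 0.
have un x : u x < n by rewrite /u; case: ifP => // _; apply: ltnW.
have uP x (y : 'I_n) : y != u x %[mod 2 * s + 1] -> val y != x.
  apply: contraNneq => yx; rewrite /u -yx ltn_ord; exact/eqP.
have [S [cS Ss Si Sj]] := arc_avoid2 (un i) (un j).
exists S; rewrite -[s]mul1n; split=> // y yS; apply: uP; [exact: Si|exact: Sj].
Qed.

Lemma complete_core_exists t d : 0 < t ->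
  complete_core (2 * t + 1 + d) (t + d) (2 * t + 1 + 3 * d).
Proof.
move=> t0; elim: d => [|d IH].
  by rewrite muln0 !addn0; apply: complete_core_cycle.
rewrite (addnS (2 * t + 1)) (addnS t) (_ : 2 * t + 1 + 3 * d.+1 = 2 * t + 1 + 3 * d + 3); last first.
  by clear; lia.
by apply: complete_core_step => //; move: t0; clear; lia.
Qed.

(* The vertex [x_i] is joined to the cycle minus the residue class of [i]; for
   [1 < c] each removed vertex still sees an [s]-clique of what is left, and
   [c <= 3] keeps the cycle from having an independent set of size [s.+2]. *)
Lemma alpha_value_cycle c h k : 1 < c <= 3 -> 0 < h -> c * (2 * h + 1) <= k ->
  exists2 m, alpha_value k (c * h).+2 m & m <= k * (2 * (c * h)).
Proof.
move=> /andP[c1 c3] h0; set n := c * (2 * h + 1) => nk.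
have nE : n = 2 * (c * h) + c by rewrite /n; clear; lia.
have n1 : 1 < n by rewrite nE; move: c1; clear; lia.
pose u (i : 'I_k) := if i < n then val i else 0.
have un i : u i < n by rewrite /u; case: ifP => // _; apply: ltnW.
pose N (i : 'I_k) : {set 'I_n} := [set y : 'I_n | y != u i %[mod 2 * h + 1]].
have NP i (S : {set 'I_n}) :
    {in S, forall y : 'I_n, y != u i %[mod 2 * h + 1]} -> S \subset N i.
  by move=> Si; apply/subsetP => y /Si; rewrite inE.
exists (\sum_i #|N i|).
  apply: (@construction k (c * h) 'I_n (widen_ord nk) (@cocycle n) N).
  - exact: cocycle_sym.
  - by move=> y z /andP[].
  - move=> S /(cocycle_clique_bound n1); rewrite [leqRHS]nE.
    by move: #|S| (c * h) c3; clear; lia.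
  - move=> i y; rewrite inE; apply: contraNneq => <-.
    by rewrite /u /= ltn_ord.
  - move=> i S /subsetP SN cS; apply: (arc_clique_bound (un i) cS).
    by move=> x /SN; rewrite inE.
  - move=> i j _; have [S [cS Ss Si Sj]] := arc_avoid2 (un i) (un j).
    by exists S; split=> //; apply: NP.
  move=> i y _; rewrite inE negbK => /eqP yi.
  have [S [cS Ss Sy yS]] := arc_avoid_neighbours y c1.
  by exists S; split=> //; apply: NP => x /Sy; rewrite yi.
rewrite -[k in leqRHS]card_ord -sum_nat_const; apply: leq_sum => i _.
(* The removed class has at least [c] elements, leaving at most [2 * (c * h)]. *)
have rn (b : 'I_c) : u i %% (2 * h + 1) + b * (2 * h + 1) < n.
  apply: leq_trans (_ : b.+1 * (2 * h + 1) <= n).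
    by rewrite mulSn ltn_add2r ltn_pmod // addn1.
  by rewrite leq_mul2r ltn_ord orbT.
pose f b : 'I_n := Ordinal (rn b).
have fI : injective f.
  move=> b b' /(congr1 val) /= /addnI/eqP; rewrite eqn_pmul2r ?addn1 // => /eqP.
  exact: val_inj.
have : #|~: N i| >= c.
  rewrite -[c in c <= _]card_ord -cardsT -(card_imset _ fI).
  apply/subset_leq_card/subsetP => _ /imsetP[b _ ->].
  by rewrite !inE negbK /= addnC modnMDl modn_mod.
have := cardsC (N i); rewrite card_ord; move: #|N i| #|~: N i| nE.
by move: (n) (c * h); clear; lia.
Qed.

(** * Evaluation of the minimum *)

(** A realised value guarantees that [xget] returns a true minimum and not its default. *)
Lemma alpha_min k r m : alpha_value k r m ->
  alpha_value k r (alpha k r) /\ alpha k r <= m.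
Proof.
move=> am; have exP : exists n, `[< alpha_value k r n >].
  by exists m; apply/asboolP.
have [n /asboolP an nmin] := ex_minnP exP.
have [a amin] : alpha_value k r (alpha k r) /\
    forall m', alpha_value k r m' -> alpha k r <= m'.
  apply: (@classical_sets.xgetPex _ 0 (fun n => alpha_value k r n /\
    forall m', alpha_value k r m' -> n <= m')).
  by exists n; split=> // m' am'; apply/nmin/asboolP.
by split=> //; apply: amin.
Qed.

Lemma alpha_le_small k s : 0 < s -> s.+2 <= k <= 2 * s + 1 ->
  alpha_value k s.+2 ((k - 1) * (4 * s + 2 - k)).
Proof.
move=> s0 /andP[sk ks]; apply: alpha_value_complete_core.
(* [t = k - s - 1] and [d = 2 * s + 1 - k] solve [2 * t + 1 + d = k] and [t + d = s]. *)
have t0 : 0 < k - s - 1 by move: sk; clear; lia.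
have := complete_core_exists (2 * s + 1 - k) t0.
have -> : 2 * (k - s - 1) + 1 + (2 * s + 1 - k) = k by move: sk ks; clear; lia.
have -> : k - s - 1 + (2 * s + 1 - k) = s by move: sk ks; clear; lia.
have -> // : 2 * (k - s - 1) + 1 + 3 * (2 * s + 1 - k) = 4 * s + 2 - k.
by move: sk ks; clear; lia.
Qed.

Lemma alpha_le_large k s : 0 < s -> 2 * s + 1 <= k ->
  alpha_value k s.+2 ((k - 1) * (2 * s + 1)).
Proof. by move=> s0 sk; apply/alpha_value_complete_core/complete_core_cycle. Qed.

Theorem theorem1p2 :
  (* (i) *)
  (forall k r : nat, 3 <= r -> r <= k ->
     (r <= k <= 2 * r - 3 ->
        k * (2 * r - 4) <= alpha k r <= (k - 1) * (4 * r - k - 6)) /\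
     (2 * r - 3 <= k ->
        k * (2 * r - 4) <= alpha k r <= (k - 1) * (2 * r - 3))) /\
  (* (ii) *)
  (forall k r : nat, 3 <= r -> r <= k ->
     [\/ k = 2 * r - 3,
         2 * r - 2 <= k /\ r = 0 %[mod 2]
       | 2 * r - 1 <= k /\ r = 2 %[mod 3]] ->
     alpha k r = k * (2 * r - 4)) /\
  (* (iii) *)
  ((forall k : nat, 3 <= k -> alpha k 3 = 3 * (k - 1)) /\
   alpha 4 4 = 18 /\
   33 <= alpha 5 5 <= 36) /\
  (* (iv) *)
  (forall r : nat, 4 <= r -> r * (2 * r - 4) + 1 <= alpha r r).
Proof.
have part_i k r : 3 <= r -> r <= k ->
     (r <= k <= 2 * r - 3 ->
        k * (2 * r - 4) <= alpha k r <= (k - 1) * (4 * r - k - 6)) /\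
     (2 * r - 3 <= k ->
        k * (2 * r - 4) <= alpha k r <= (k - 1) * (2 * r - 3)).
  case: r => [|[|s]] // s0 sk; have k2 : 1 < k by apply: leq_trans sk.
  have -> : 2 * s.+2 - 4 = 2 * s by clear; lia.
  have -> : 2 * s.+2 - 3 = 2 * s + 1 by clear; lia.
  have -> : 4 * s.+2 - k - 6 = 4 * s + 2 - k by clear; lia.
  split=> [ks|ks].
    have [a ->] := alpha_min (alpha_le_small s0 ks).
    by rewrite (alpha_value_ge k2 a).
  have [a ->] := alpha_min (alpha_le_large s0 ks).
  by rewrite (alpha_value_ge k2 a).
split=> //; split; last split.
- move=> k r r3 rk H.
  suff [m am mk] : exists2 m, alpha_value k r m & m <= k * (2 * r - 4).
    have [a am'] := alpha_min am.
    apply/eqP; rewrite eqn_leq (leq_trans am' mk).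
    case: r r3 rk {H am am' mk} a => [|[|s]] // s0 sk a.
    have k2 : 1 < k by apply: leq_trans sk.
    have -> : 2 * s.+2 - 4 = 2 * s by clear; lia.
    exact: alpha_value_ge a.
  case: H => [kE|[rk' r2]|[rk' r3']].
  + case: r r3 rk kE => [|[|s]] // s0 sk kE.
    (* For [k = 2 * s + 1] this equals [k * (2 * s)], the lower bound. *)
    exists ((k - 1) * (2 * s + 1)).
      by apply: alpha_le_large => //; move: kE; clear; lia.
    have -> : 2 * s.+2 - 4 = k - 1 by rewrite kE; clear; lia.
    by have -> : 2 * s + 1 = k; [move: kE; clear; lia|rewrite mulnC].
  + have rE : r = (2 * (r./2.-1)).+2.
      have := divn_eq r 2; rewrite r2 -divn2 mod0n; move: r3; clear; lia.
    have [||m am mk] := @alpha_value_cycle 2 (r./2.-1) k isT.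
    * by move: rE r3; clear; lia.
    * by move: rE rk'; clear; lia.
    exists m; first by rewrite rE.
    by rewrite (_ : 2 * r - 4 = 2 * (2 * r./2.-1)) //; move: rE; clear; lia.
  + pose h := (r - 2) %/ 3; have rE : r = (3 * h).+2.
      by rewrite /h; move: r3 r3'; clear; lia.
    have [||m am mk] := @alpha_value_cycle 3 h k isT.
    * by move: rE r3; clear; lia.
    * by move: rE rk'; clear; lia.
    exists m; first by rewrite rE.
    by rewrite (_ : 2 * r - 4 = 2 * (3 * h)) //; move: rE; clear; lia.
- split=> [k k3|].
    have [a le] := alpha_min (@alpha_le_large k 1 isT k3).
    by apply/eqP; rewrite eqn_leq alpha_value_triangle_ge // mulnC le.
  split.
    have [a le] := alpha_min (@alpha_le_small 4 2 isT isT).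
    by apply/eqP; rewrite eqn_leq le (@alpha_value_diag_ge 2).
  have [a le] := alpha_min (@alpha_le_small 5 3 isT isT).
  by rewrite le alpha_value_five_ge.
- case=> [|[|s]] // s2; have s1 : 1 < s by move: s2; clear; lia.
  have [|a _] := alpha_min (@alpha_le_small s.+2 s (ltnW s1) _).
    by move: s1; clear; lia.
  have -> : 2 * s.+2 - 4 = 2 * s by clear; lia.
  apply: leq_trans (alpha_value_diag_ge s1 a); by rewrite leq_add2l.
Qed.
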